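(* Let $B$ satisfy the standing assumptions below and let $\xi_0\in\mathcal{M}$. Let $T_{\xi_0}$ be the supremum of the set of $T>0$ such that the flow equation $\xi_t=\varphi^{t,B(\xi)}_\sharp\xi_0$ has a unique current-valued solution on $[0,T]$, and let $\xi\in C([0,T_{\xi_0});\mathcal{M})$ be the corresponding maximal solution. If $T_{\xi_0}<\infty$, then $\lim_{t\to T_{\xi_0}^-}\|\xi_t\|=+\infty$.
   Context: $\mathcal{M}$ is the dual of $C_b(\mathbb{R}^d;\mathbb{R}^d)$ (bounded continuous vector fields, sup norm $\|\cdot\|_\infty$) with dual norm $|\xi|_{\mathcal{M}}=\sup_{\|\theta\|_\infty\le1}|\xi(\theta)|$. Weak norm: $\|\xi\|=\sup\{\xi(\theta):\|\theta\|_\infty+\mathrm{Lip}(\theta)\le1\}$; $\mathcal{M}_w$ is $\mathcal{M}$ with metric $d(\xi,\xi')=\|\xi-\xi'\|$. Standing assumptions: $B:\mathcal{M}_w\to C_b^2(\mathbb{R}^d,\mathbb{R}^d)$ is continuous and there is $C_B>0$ with, for all $\xi,\xi'$: $\|B(\xi)\|_{C_b^2}\le C_B(\|\xi\|+1)$, $\|B(\xi)-B(\xi')\|_\infty\le C_B\|\xi-\xi'\|$, $\|DB(\xi)-DB(\xi')\|_\infty\le C_B\|\xi-\xi'\|$ ($D$ the spatial derivative). $\varphi^{t,B(\xi)}$ is the flow of $\frac{dx_t}{dt}=B(\xi_t)(x_t)$ with $\varphi^{0,B(\xi)}=\mathrm{id}$. Push-forward: $(\varphi_\sharp\theta)(x)=D\varphi(x)^T\theta(\varphi(x))$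 and $(\varphi_\sharp\xi)(\theta)=\xi(\varphi_\sharp\theta)$. *)

(* Defs.v *)
From HB Require Import structures.
From mathcomp Require Import all_boot all_order all_algebra.
From mathcomp Require Import all_classical all_reals all_analysis.
Set Implicit Arguments. Unset Strict Implicit. Unset Printing Implicit Defensive.
Import Order.TTheory GRing.Theory Num.Theory.
Import numFieldNormedType.Exports.
Local Open Scope classical_set_scope.
Local Open Scope ring_scope.

Section Defs.
Variables (R : realType) (d : nat).
Local Notation V := 'rV[R]_d.

Definition ebas (i : 'I_d) : V := delta_mx 0 i.

Definition Cb (th : V -> V) : Prop :=
  continuous th /\ exists M : R, forall x, `|th x| <= M.

(** a "current": an element of the dual of C_b (values outside C_b are irrelevant;
    currents are compared only on C_b) *)
Definition is_current (xi : (V -> V) -> R) : Prop :=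
  (forall (a b : R) (th th' : V -> V), Cb th -> Cb th' ->
     xi (fun x => a *: th x + b *: th' x) = a * xi th + b * xi th') /\
  exists C : R, forall th, Cb th -> forall M : R, (forall x, `|th x| <= M) ->
     `|xi th| <= C * M.

Definition lip1 (th : V -> V) : Prop :=
  exists a b : R, [/\ 0 <= a, 0 <= b, a + b <= 1,
    (forall x, `|th x| <= a) & (forall x y, `|th x - th y| <= b * `|x - y|)].

Definition wnorm (xi : (V -> V) -> R) : R := sup [set xi th | th in lip1].

Definition cdiff (xi xi' : (V -> V) -> R) : (V -> V) -> R := fun th => xi th - xi' th.

Definition C2 (f : V -> V) : Prop :=
  continuous f /\
  forall i : 'I_d, (forall x, derivable f x (ebas i)) /\ continuous ('D_(ebas i) f) /\
  forall j : 'I_d, (forall x, derivable ('D_(ebas i) f) x (ebas j)) /\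
                   continuous ('D_(ebas j) ('D_(ebas i) f)).

Definition C2_bound (f : V -> V) (K : R) : Prop :=
  forall x, `|f x| <= K /\ forall i j : 'I_d,
    `|'D_(ebas i) f x| <= K /\ `|'D_(ebas j) ('D_(ebas i) f) x| <= K.

Definition standing (B : ((V -> V) -> R) -> V -> V) (CB : R) : Prop :=
  0 < CB /\
  (forall xi, is_current xi -> C2 (B xi)) /\
  (forall xi, is_current xi -> forall eps : R, 0 < eps -> exists2 delta : R, 0 < delta &
     forall xi', is_current xi' -> wnorm (cdiff xi' xi) < delta ->
       C2_bound (fun x => B xi' x - B xi x) eps) /\
  (forall xi, is_current xi -> C2_bound (B xi) (CB * (wnorm xi + 1))) /\
  (forall xi xi', is_current xi -> is_current xi' -> forall x,
     `|B xi x - B xi' x| <= CB * wnorm (cdiff xi xi')) /\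
  (forall xi xi', is_current xi -> is_current xi' -> forall x (i : 'I_d),
     `|'D_(ebas i) (B xi) x - 'D_(ebas i) (B xi') x| <= CB * wnorm (cdiff xi xi')).

(** push-forward of a vector field: (phi# th)(x) = Dphi(x)^T th(phi x) *)
Definition push (phi : V -> V) (th : V -> V) : V -> V :=
  fun x => \row_j (\sum_i (th (phi x)) 0 i * ('D_(ebas j) phi x) 0 i).

Definition flow_on (B : ((V -> V) -> R) -> V -> V) (xi : R -> (V -> V) -> R)
    (T : R) (phi : R -> V -> V) : Prop :=
  forall x, phi 0 x = x /\
    {within `[0, T], continuous (fun s => phi s x)} /\
    forall t, 0 < t < T -> is_derive t 1 (fun s => phi s x) (B (xi t) (phi t x)).

Definition sol_on (B : ((V -> V) -> R) -> V -> V) (xi0 : (V -> V) -> R)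
    (T : R) (xi : R -> (V -> V) -> R) : Prop :=
  (forall t, 0 <= t <= T -> is_current (xi t)) /\
  (forall t, 0 <= t <= T -> forall eps : R, 0 < eps -> exists2 delta : R, 0 < delta &
     forall s, 0 <= s <= T -> `|s - t| < delta -> wnorm (cdiff (xi s) (xi t)) < eps) /\
  exists phi, flow_on B xi T phi /\
    forall t, 0 <= t <= T -> forall th, Cb th -> xi t th = xi0 (push (phi t) th).

Definition unique_sol_on B xi0 (T : R) : Prop :=
  (exists xi, sol_on B xi0 T xi) /\
  forall xi xi', sol_on B xi0 T xi -> sol_on B xi0 T xi' ->
    forall t, 0 <= t <= T -> forall th, Cb th -> xi t th = xi' t th.

End Defs.

(* Main.v *)
Require Import Defs.
From HB Require Import structures.
From mathcomp Require Import all_boot all_order all_algebra.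
From mathcomp Require Import all_classical all_reals all_analysis.
From mathcomp Require Import ring lra.
Import Order.TTheory GRing.Theory Num.Theory.
Import numFieldNormedType.Exports.
Local Open Scope classical_set_scope.
Local Open Scope ring_scope.
Set Implicit Arguments. Unset Strict Implicit. Unset Printing Implicit Defensive.

(** Suppose the weak norm does not tend to infinity: it stays below some [M] along times
    approaching [Tmax].  Over a short time interval the flow is close to the identity in
    C^{1,1}, and the push-forward of a current by a C^{1,1} map is controlled in the weak
    norm; a bootstrap argument started at one such time therefore bounds the weak norm on
    all of [[0, Tmax)].  Then the velocity fields are uniformly bounded in C^2, so the flow
    and its differential stay bounded up to [Tmax].  The coupled system for the pair
    (flow, differential) is a Lipschitz differential equation whose existence time depends
    only on a bound for the differential and on the strong norm of [xi0]: restarting it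
    just before [Tmax] gives a solution beyond [Tmax], which is unique by a Gronwall
    argument, contradicting maximality.

    Maps are handled through the quantitative class [C11 phi J A L] ([phi] has differential
    [J] with a quadratic remainder): it consists of inequalities on finitely many values,
    hence it is stable under composition, time integration and limits, so that no theorem
    about differentiating integrals or limits is required. *)

(** * Scalar functions with a prescribed derivative, and the mean value inequality *)

Section Calculus.
Variable R : realType.
Implicit Types (a b c t : R) (f g : R -> R).

(** The derivative is prescribed in the open interval and continuity on the closed one: this is what
    [flow_on] supplies and what the mean value theorem consumes. *)
Definition evolves a b f (f' : R -> R) : Prop :=
  {within `[a, b], continuous f} /\
  forall t, a < t < b -> is_derive t 1 f (f' t).

Lemma evolves_sub a b c d f f' : a <= c -> d <= b ->
  evolves a b f f' -> evolves c d f f'.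
Proof.
move=> ac db [cf df]; split.
  apply: continuous_subspaceW cf => x /=; rewrite !in_itv /= => /andP[cx xd].
  by rewrite (le_trans ac cx) (le_trans xd db).
move=> t /andP[ct td]; apply: df.
by rewrite (le_lt_trans ac ct) (lt_le_trans td db).
Qed.

Lemma evolves_ext a b f f' g' : (forall t, a < t < b -> f' t = g' t) ->
  evolves a b f f' -> evolves a b f g'.
Proof. by move=> e [cf df]; split => // t h; rewrite -e //; exact: df. Qed.

Lemma evolvesI a b f f' : (forall t, a <= t <= b -> is_derive t 1 f (f' t)) ->
  evolves a b f f'.
Proof.
move=> df; split => [|t /andP[/ltW at_ /ltW tb]]; last by apply: df; rewrite at_.
apply: derivable_within_continuous => t; rewrite in_itv /= => h.
by have [] := df t h.
Qed.

Lemma evolvesT a b f f' : (forall t, is_derive t 1 f (f' t)) -> evolves a b f f'.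
Proof. by move=> df; apply: evolvesI. Qed.

Lemma evolvesB a b f f' g g' : evolves a b f f' -> evolves a b g g' ->
  evolves a b (fun t => f t - g t) (fun t => f' t - g' t).
Proof.
move=> [cf df] [cg dg]; split.
  by move=> x; apply: cvgB; [exact: cf|exact: cg].
by move=> t h; apply: is_deriveB; [exact: df|exact: dg].
Qed.

Lemma evolves_cst a b c : evolves a b (fun=> c) (fun=> 0).
Proof. by apply: evolvesT => t; exact: is_derive_cst. Qed.

Lemma evolvesZ a b c f f' : evolves a b f f' ->
  evolves a b (fun t => c * f t) (fun t => c * f' t).
Proof.
move=> [cf df]; split.
  by move=> x; apply: cvgM; [exact: cvg_cst|exact: cf].
by move=> t h; apply: is_deriveZ; exact: df.
Qed.

Lemma evolvesD a b f f' g g' : evolves a b f f' -> evolves a b g g' ->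
  evolves a b (fun t => f t + g t) (fun t => f' t + g' t).
Proof.
move=> [cf df] [cg dg]; split.
  by move=> x; apply: cvgD; [exact: cf|exact: cg].
by move=> t h; apply: is_deriveD; [exact: df|exact: dg].
Qed.

Lemma evolves_sum (I : Type) (r : seq I) a b (F F' : I -> R -> R) :
  (forall i, evolves a b (F i) (F' i)) ->
  evolves a b (fun t => \sum_(i <- r) F i t) (fun t => \sum_(i <- r) F' i t).
Proof.
move=> h; elim: r => [|i r IH].
  under eq_fun do rewrite big_nil.
  under [X in evolves _ _ _ X]eq_fun do rewrite big_nil.
  exact: evolves_cst.
under eq_fun do rewrite big_cons.
under [X in evolves _ _ _ X]eq_fun do rewrite big_cons.
exact: evolvesD.
Qed.

(** The mean value theorem is applied to [g - s f] for [s = 1] and [s = -1]. All later integrations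
    of differential inequalities reduce to this lemma. *)
Lemma evolves_le a b f f' g g' : a <= b -> evolves a b f f' -> evolves a b g g' ->
  (forall t, a < t < b -> `|f' t| <= g' t) -> `|f b - f a| <= g b - g a.
Proof.
move=> ab ef eg h.
have key (s : R) : `|s| = 1 -> s * (f b - f a) <= g b - g a.
  move=> s1.
  have [ch dh] := evolvesB eg (evolvesZ s ef).
  move: (ab); rewrite le_eqVlt => /orP[/eqP abE|altb].
    by rewrite abE !subrr mulr0.
  have [y yab] := MVT altb (fun t ht => dh t ht) ch.
  have /h hy : a < y < b by move: yab; rewrite in_itv.
  have : s * f' y <= g' y.
    by rewrite (le_trans (ler_norm _)) // normrM s1 mul1r.
  rewrite -subr_ge0 => /mulr_ge0 /(_ (_ : 0 <= b - a)).
  rewrite subr_ge0 => /(_ ab) p q.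
  by move: p; rewrite -q mulrBr; lra.
rewrite ler_norml; apply/andP; split.
  by have := key (-1) (normrN1 _); lra.
by have := key 1 (normr1 _); lra.
Qed.

Lemma continuous_primitive f a : continuous f ->
  exists F : R -> R, F a = 0 /\ forall t, a <= t -> is_derive t 1 F (f t).
Proof.
move=> cf.
(* Integrating from [a - 1] makes [a] an interior point, so that the derivative at [a] is
   two-sided. *)
pose G x := \int[lebesgue_measure]_(t in `[a - 1, x]) f t.
exists (fun x => G x - G a); split; first by rewrite subrr.
move=> t at_.
have int : lebesgue_measure.-integrable `[a - 1, t + 1] (EFin \o f).
  by apply: continuous_compact_integrable; [exact: segment_compact|exact: continuous_subspaceT].
have tt1 : t < t + 1 by lra.
have a1t : a - 1 < t by lra.
have [d1 d2] := continuous_FTC1_closed tt1 int a1t (cf t).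
rewrite -[f t]subr0; apply: is_deriveB.
by apply: DeriveDef => //; rewrite -derive1E.
Qed.

End Calculus.

(** * Picard iteration in an invariant family of sets *)

Section Picard.
Variable R : realType.

Lemma le0_geometric (x c : R) : (forall n, x <= c / 2 ^+ n) -> x <= 0.
Proof.
move=> h; rewrite leNgt; apply/negP => x0.
have c0 : 0 < c by have := h 0%N; rewrite expr0 divr1; lra.
have [n] : exists n : nat, c / x < n%:R.
  by exists (Num.bound (c / x)); rewrite archi_boundP // divr_ge0 // ltW.
rewrite ltr_pdivrMr // => cn; have := h n.
rewrite ler_pdivlMr ?exprn_gt0 // => /le_lt_trans/(_ cn).
rewrite mulrC ltr_pM2r // ltNge.
by rewrite -natrX ler_nat ltnW // ltn_expl.
Qed.

(** The tail of the series from index [n] is at most [2 C / 2^n]. Subtracting or adding this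
    quantity gives an increasing and a decreasing sequence, and the supremum of the first lies below
    the second. *)
Lemma geometric_limit (v : nat -> R) (C : R) :
  (forall n, `|v n.+1 - v n| <= C / 2 ^+ n) ->
  exists l, forall n, `|v n - l| <= 2 * C / 2 ^+ n.
Proof.
move=> h.
have halve n : 2 * C / 2 ^+ n = C / 2 ^+ n + 2 * C / 2 ^+ n.+1.
  by rewrite exprS; field; rewrite expf_neq0.
pose w n := v n - 2 * C / 2 ^+ n; pose z n := v n + 2 * C / 2 ^+ n.
have wS n : w n <= w n.+1.
  rewrite /w (halve n); have := h n; move: (C / _) (2 * C / _) => p q hn.
  by move: hn; rewrite ler_norml => /andP[]; lra.
have zS n : z n.+1 <= z n.
  rewrite /z (halve n); have := h n; move: (C / _) (2 * C / _) => p q hn.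
  by move: hn; rewrite ler_norml => /andP[]; lra.
have wm m n : (m <= n)%N -> w m <= w n.
  elim: n => [|n IH]; first by rewrite leqn0 => /eqP->.
  by rewrite leq_eqVlt => /orP[/eqP->//|/IH]; move=> /le_trans; apply.
have zm m n : (m <= n)%N -> z n <= z m.
  elim: n => [|n IH]; first by rewrite leqn0 => /eqP->.
  by rewrite leq_eqVlt => /orP[/eqP->//|/IH]; apply: le_trans.
have C0 : 0 <= C by have := h 0%N; rewrite expr0 divr1; apply: le_trans.
have wz n : w n <= z n.
  have : 0 <= 2 * C / 2 ^+ n by rewrite divr_ge0 ?exprn_ge0 ?mulr_ge0.
  by rewrite /w /z; lra.
have wzmn m n : w m <= z n.
  apply: (le_trans (wm _ _ (leq_maxl m n))); apply: (le_trans (wz _)).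
  exact: (zm _ _ (leq_maxr m n)).
pose A := [set w n | n in setT].
exists (sup A) => n.
have u : w n <= sup A.
  by apply: ub_le_sup; [exists (z 0%N) => _ [m _ <-]; exact: wzmn|exists n].
have l : sup A <= z n.
  by apply: ge_sup; [exists (w 0%N); exists 0%N|move=> _ [m _ <-]; exact: wzmn].
by rewrite ler_norml; move: u l; rewrite /w /z => u l; apply/andP; split; lra.
Qed.

(** Projection onto the interval, used to extend functions of time to the whole line, where
    primitives of continuous functions are available. *)
Definition clamp (a b t : R) : R := Num.max a (Num.min b t).

Lemma clamp_bounds a b t : a <= b -> a <= clamp a b t <= b.
Proof. by move=> ab; rewrite /clamp le_max lexx /= ge_max ab /= ge_min lexx. Qed.

Lemma clamp_id a b t : a <= t <= b -> clamp a b t = t.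
Proof. by move=> /andP[at_ tb]; rewrite /clamp (min_idPr tb) (max_idPr at_). Qed.

Lemma clamp_lipschitz a b s t : `|clamp a b s - clamp a b t| <= `|s - t|.
Proof.
have key u v : u <= v -> 0 <= clamp a b v - clamp a b u <= v - u.
  rewrite /clamp => uv.
  by case: (leP b u) => ?; case: (leP b v) => ?; case: (leP a b) => ?;
    case: (leP a u) => ?; case: (leP a v) => ?; lra.
have [/key|/ltW/key] := leP s t => /andP[h0 h1].
  by rewrite distrC (distrC s) ger0_norm // (le_trans h1) // ler_norm.
by rewrite ger0_norm // (le_trans h1) // ler_norm.
Qed.

Lemma evolves_exp (a b k c : R) :
  evolves a b (fun t => c * expR (k * (t - a))) (fun t => c * (k * expR (k * (t - a)))).
Proof.
apply/evolvesZ/evolvesT => t.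
have h : is_derive t 1 (fun t => k * (t - a)) k.
  rewrite -[X in is_derive _ _ _ X]mulr1 -[X in _ * X]subr0.
  by apply: is_deriveZ; apply: is_deriveB.
have := is_derive1_comp (is_derive_expR _) h.
by rewrite mulrC; exact.
Qed.

Variables (X : Type) (a b L M : R) (F : R -> (X -> R) -> X -> R) (u0 : X -> R).
Variable S : R -> (X -> R) -> Prop.

(** The unknown is a family of reals indexed by an arbitrary type [X] and compared uniformly, so no
    function space has to be built. [S t] is a time-dependent closed set, stable under the Picard
    step, on which [F] is bounded by [M] and Lipschitz. *)
Definition trajectory (u : R -> X -> R) : Prop :=
  (forall t, a <= t <= b -> S t (u t)) /\
  forall s t, a <= s <= b -> a <= t <= b -> forall x,
    `|u s x - u t x| <= M * `|s - t|.

Definition picard_step (u w : R -> X -> R) : Prop :=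
  w a = u0 /\ forall x, evolves a b (w^~ x) (fun t => F t (u t) x).

Hypotheses (ab : a <= b) (L0 : 0 < L) (M0 : 0 <= M).
Hypothesis S0 : forall t, a <= t <= b -> S t u0.
Hypothesis FM : forall t u x, a <= t <= b -> S t u -> `|F t u x| <= M.
Hypothesis FL : forall t u v (e : R), a <= t <= b -> S t u -> S t v ->
  (forall x, `|u x - v x| <= e) -> forall x, `|F t u x - F t v x| <= L * e.
Hypothesis Fcont : forall u x, trajectory u ->
  continuous (fun s => F (clamp a b s) (u (clamp a b s)) x).
Hypothesis Sstep : forall u w, trajectory u -> picard_step u w ->
  forall t, a <= t <= b -> S t (w t).
Hypothesis Sclosed : forall t u, a <= t <= b ->
  (forall e : R, 0 < e -> exists v, S t v /\ forall x, `|u x - v x| <= e) -> S t u.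

Lemma picard_step_exists u : trajectory u -> exists w, picard_step u w.
Proof.
move=> tu.
have /choice [P Pp] x := continuous_primitive a (@Fcont u x tu).
exists (fun t x => u0 x + P x t); split.
  by apply/funext => x; rewrite (Pp x).1 addr0.
move=> x; have : evolves a b (fun t => u0 x + P x t)
    (fun t => 0 + F (clamp a b t) (u (clamp a b t)) x).
  apply: evolvesD; first exact: evolves_cst.
  by apply: evolvesI => t /andP[at_ _]; exact: (Pp x).2.
apply: evolves_ext => t /andP[/ltW at_ /ltW tb].
by rewrite add0r clamp_id // at_ tb.
Qed.

Lemma picard_step_trajectory u w : trajectory u -> picard_step u w -> trajectory w.
Proof.
move=> tu pw; split; first exact: (Sstep tu pw).
have key s t x : a <= s -> s <= t -> t <= b -> `|w t x - w s x| <= M * (t - s).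
  move=> as_ st tb; rewrite mulrBr.
  apply: (@evolves_le _ s t (w^~ x) (fun r => F r (u r) x) (fun r => M * r) (fun r => M * 1)) => //.
  - exact: evolves_sub as_ tb (pw.2 x).
  - by apply/evolvesZ/evolvesT => r; exact: is_derive_id.
  - move=> r /andP[/ltW sr /ltW rt]; rewrite mulr1.
    have rab : a <= r <= b by rewrite (le_trans as_ sr) (le_trans rt tb).
    by apply: FM => //; exact: tu.1.
move=> s t /andP[as_ sb] /andP[at_ tb] x.
have [st|/ltW ts] := leP s t.
  by rewrite distrC (distrC s t) [`|t - s|]ger0_norm ?subr_ge0 //; apply: key.
by rewrite [`|s - t|]ger0_norm ?subr_ge0 //; apply: key.
Qed.

Lemma expR_ge1_on t : a <= t -> 1 <= expR (2 * L * (t - a)).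
Proof. by move=> at_; rewrite -expR0 ler_expR mulr_ge0 ?subr_ge0 // mulr_ge0 // ltW. Qed.

(** With the weight [expR (2 L (t - a))] the step halves distances over the whole interval, so
    [b - a] need not be small: the derivative of [C / 2] times the weight is exactly [L C] times the
    weight. *)
Lemma picard_step_contract u v w z (C : R) :
  trajectory u -> trajectory v -> picard_step u w -> picard_step v z ->
  (forall t x, a <= t <= b -> `|u t x - v t x| <= C * expR (2 * L * (t - a))) ->
  forall t x, a <= t <= b -> `|w t x - z t x| <= C / 2 * expR (2 * L * (t - a)).
Proof.
move=> tu tv pw pz h t x /andP[at_ tb].
have C0 : 0 <= C.
  have := h a x; rewrite lexx ab subrr mulr0 expR0 mulr1 => /(_ isT).
  exact: le_trans.
have := @evolves_le _ a t _ _ _ _ at_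
  (evolvesB (evolves_sub (lexx _) tb (pw.2 x)) (evolves_sub (lexx _) tb (pz.2 x)))
  (evolves_exp a t (2 * L) (C / 2)).
rewrite pw.1 pz.1 subrr subr0 => /(_ _)/le_trans; apply.
- move=> s /andP[/ltW as_ /ltW st].
  have sab : a <= s <= b by rewrite as_ (le_trans st tb).
  apply: le_trans (FL sab (tu.1 _ sab) (tv.1 _ sab) (fun x => h s x sab) x) _.
  by rewrite le_eqVlt; apply/orP; left; apply/eqP; field.
- rewrite subrr mulr0 expR0 mulr1; lra.
Qed.

Theorem picard : exists u, [/\ trajectory u, u a = u0 &
  forall x, evolves a b (u^~ x) (fun t => F t (u t) x)].
Proof.
have t0 : trajectory (fun=> u0).
  by split => // s t _ _ x; rewrite subrr normr0 mulr_ge0.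
(* A Picard step is a relation here, since primitives are only known to exist; choosing a successor
   for each trajectory makes iteration possible. *)
have next (u : {u | trajectory u}) : {w : {w | trajectory w} | picard_step (sval u) (sval w)}.
  have [w pw] := cid (picard_step_exists (svalP u)).
  by exists (exist _ w (picard_step_trajectory (svalP u) pw)).
pose U n := iter n (fun u => sval (next u)) (exist _ (fun=> u0) t0).
pose un n := sval (U n).
have tun n : trajectory (un n) := svalP (U n).
have pun n : picard_step (un n) (un n.+1) := svalP (next (U n)).
have step n t x : a <= t <= b ->
    `|un n.+1 t x - un n t x| <= M * (b - a) / 2 ^+ n * expR (2 * L * (t - a)).
  elim: n t x => [t x tab|n IH t x tab].
    rewrite expr0 divr1; have aab : a <= a <= b by rewrite lexx ab.
    have -> : un 0%N t x = un 1%N a x by rewrite (pun 0%N).1.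
    have /andP[at_ tb] := tab.
    apply: le_trans ((tun 1%N).2 t a tab aab x) _.
    rewrite -[leLHS]mulr1 ger0_norm ?subr_ge0 //.
    by apply: ler_pM; rewrite ?mulr_ge0 ?subr_ge0 ?ler_wpM2l ?lerB ?expR_ge1_on.
  have := picard_step_contract (tun n.+1) (tun n) (pun n.+1) (pun n) IH x tab.
  by rewrite exprS (_ : M * (b - a) / (2 * 2 ^+ n) = M * (b - a) / 2 ^+ n / 2) //;
    field; rewrite expf_neq0.
pose D := M * (b - a) * expR (2 * L * (b - a)).
have stepD n t x : a <= t <= b -> `|un n.+1 t x - un n t x| <= D / 2 ^+ n.
  move=> tab; apply: (le_trans (step n t x tab)).
  rewrite /D -[leRHS]mulrAC ler_wpM2l ?divr_ge0 ?exprn_ge0 ?mulr_ge0 ?subr_ge0 //.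
  rewrite ler_expR ler_wpM2l ?mulr_ge0 ?(ltW L0) // lerB //.
  by case/andP: tab.
(* The limit is total in [t]; outside the interval it takes the default value 0. *)
have lim t x : exists l, a <= t <= b -> forall n, `|un n t x - l| <= 2 * D / 2 ^+ n.
  have [tab|tab] := boolP (a <= t <= b); last by exists 0.
  by have [l hl] := geometric_limit (fun n => stepD n t x tab); exists l.
have [u hu] : exists u : R -> X -> R, forall t x, a <= t <= b ->
    forall n, `|un n t x - u t x| <= 2 * D / 2 ^+ n.
  exists (fun t x => projT1 (cid (lim t x))) => t x.
  exact: projT2 (cid (lim t x)).
have small (c e : R) : 0 < e -> exists n, c / 2 ^+ n <= e.
  move=> e0; apply: contrapT => /forallNP h.
  suff : e <= 0 by lra.
  by apply: (@le0_geometric _ c) => n; have /negP := h n; rewrite -ltNge => /ltW.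
have tu : trajectory u.
  split=> [t tab|s t sab tab x].
    apply: Sclosed => // e e0; have [n hn] := small (2 * D) e e0.
    exists (un n t); split; first exact: (tun n).1.
    by move=> x; rewrite distrC; apply: le_trans (hu t x tab n) hn.
  rewrite -subr_le0; apply: (@le0_geometric _ (4 * D)) => n.
  have := (tun n).2 s t sab tab x.
  have := ler_distD (un n s x) (u s x) (u t x).
  have := ler_distD (un n t x) (un n s x) (u t x).
  have := hu s x sab n; have := hu t x tab n.
  rewrite (distrC (u s x) (un n s x)).
  rewrite (_ : 4 * D / 2 ^+ n = 2 * D / 2 ^+ n + 2 * D / 2 ^+ n); first lra.
  by field; rewrite expf_neq0.
(* The limit [u] is not yet known to be differentiable. Its Picard step [w] is, and [w] agrees with
   [u] on the interval because both are close to [un n.+1]. *)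
have [w pw] := picard_step_exists tu.
have wu t : a <= t <= b -> w t = u t.
  move=> tab; apply/funext => x; apply/eqP; rewrite -subr_eq0 -normr_le0.
  apply: (@le0_geometric _ (2 * D * (1 + expR (2 * L * (b - a))))) => n.
  have h (s : R) y : a <= s <= b -> `|u s y - un n s y| <= 2 * D / 2 ^+ n * expR (2 * L * (s - a)).
    move=> sab; rewrite distrC; apply: le_trans (hu s y sab n) _.
    rewrite ler_peMr ?expR_ge1_on //; last by case/andP: sab.
    exact: le_trans (hu s y sab n).
  have k1 := picard_step_contract tu (tun n) pw (pun n) h x tab.
  have k2 := hu t x tab n.+1.
  have D0 : 0 <= 2 * D / 2 ^+ n by exact: le_trans (hu t x tab n).
  have k3 : 2 * D / 2 ^+ n / 2 * expR (2 * L * (t - a)) <= 2 * D / 2 ^+ n * expR (2 * L * (b - a)).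
    have e1 : expR (2 * L * (t - a)) <= expR (2 * L * (b - a)).
      rewrite ler_expR ler_wpM2l ?mulr_ge0 ?(ltW L0) // lerB //.
      by case/andP: tab.
    have := ler_wpM2l D0 e1; have := mulr_ge0 D0 (expR_ge0 (2 * L * (t - a))); lra.
  have k4 : 2 * D / 2 ^+ n.+1 <= 2 * D / 2 ^+ n.
    by rewrite exprS invfM mulrA mulrAC ler_pdivrMr //; lra.
  have := ler_distD (un n.+1 t x) (w t x) (u t x).
  rewrite [in X in _ -> _ <= X]mulrDr mulr1 [in X in _ -> _ <= X]mulrDl.
  rewrite [2 * D * _ / _]mulrAC; lra.
exists w; split; [exact: picard_step_trajectory pw|exact: pw.1|move=> x].
apply: evolves_ext (pw.2 x) => t /andP[/ltW at_ /ltW tb].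
by rewrite wu // at_ tb.
Qed.

End Picard.

(** * Evolution of matrices in the sup norm *)

Section MatrixNorm.
Variable R : realType.

Lemma mx_coord_le m n (M : 'M[R]_(m, n)) i j : `|M i j| <= `|M|.
Proof.
rewrite [`|M|]mx_normrE; exact: (@le_bigmax _ _ _ _ (fun k => `|M k.1 k.2|) (i, j)).
Qed.

Lemma mx_norm_le m n (M : 'M[R]_(m, n)) (c : R) : 0 <= c ->
  (forall i j, `|M i j| <= c) -> `|M| <= c.
Proof.
by move=> c0 h; rewrite [`|M|]mx_normrE; apply/bigmax_leP; split => // -[i j] _; exact: h.
Qed.

(** Coordinatewise, so that scalar calculus suffices. The norm being the largest coordinate,
    [mevolves_le] loses no constant. *)
Definition mevolves m n (a b : R) (f f' : R -> 'M[R]_(m, n)) : Prop :=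
  forall i j, evolves a b (fun t => f t i j) (fun t => f' t i j).

Lemma mevolves_sub m n (a b c d : R) (f f' : R -> 'M[R]_(m, n)) : a <= c -> d <= b ->
  mevolves a b f f' -> mevolves c d f f'.
Proof. by move=> ac db h i j; exact: evolves_sub (h i j). Qed.

Lemma mevolvesB m n (a b : R) (f f' g g' : R -> 'M[R]_(m, n)) :
  mevolves a b f f' -> mevolves a b g g' ->
  mevolves a b (fun t => f t - g t) (fun t => f' t - g' t).
Proof.
move=> hf hg i j; under eq_fun do rewrite !mxE.
under [X in evolves _ _ _ X]eq_fun do rewrite !mxE.
exact: evolvesB.
Qed.

Lemma mevolvesMl p m n (v : 'M[R]_(p, m)) (a b : R) (f f' : R -> 'M[R]_(m, n)) :
  mevolves a b f f' -> mevolves a b (fun t => v *m f t) (fun t => v *m f' t).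
Proof.
move=> h i j; under eq_fun do rewrite !mxE.
under [X in evolves _ _ _ X]eq_fun do rewrite !mxE.
by apply: evolves_sum => k; apply: evolvesZ.
Qed.

Lemma mevolves_le m n (a b : R) (f f' : R -> 'M[R]_(m, n)) g g' : a <= b ->
  mevolves a b f f' -> evolves a b g g' ->
  (forall t, a < t < b -> `|f' t| <= g' t) -> `|f b - f a| <= g b - g a.
Proof.
move=> ab hf hg h; apply: mx_norm_le.
  have := @evolves_le _ a b (fun=> 0) (fun=> 0) g g' ab (evolves_cst a b 0) hg.
  rewrite subrr normr0; apply => t tab; exact: le_trans (h t tab).
move=> i j; rewrite !mxE; apply: evolves_le (hf i j) hg _ => // t tab.
exact: le_trans (mx_coord_le _ _ _) (h t tab).
Qed.

Lemma mevolves_derive n (a b t : R) (f f' : R -> 'rV[R]_n) : a < t < b ->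
  mevolves a b f f' -> is_derive t 1 f (f' t).
Proof.
move=> tab h; have D : derivable f t 1.
  by apply/derivable_mxP => i j; have [_ /(_ t tab) []] := h i j.
apply: DeriveDef => //; rewrite derive_mx //; apply/matrixP => i j; rewrite mxE.
by have [_ /(_ t tab) []] := h i j.
Qed.

Lemma derive_mx_coord m n (W : normedModType R) (f : W -> 'M[R]_(m, n)) x v df :
  is_derive x v f df -> forall i j, is_derive x v (fun y => f y i j) (df i j).
Proof.
move=> [D E] i j; have Dij := (derivable_mxP f x v).1 D i j.
by apply: DeriveDef => //; rewrite -E derive_mx // mxE.
Qed.

End MatrixNorm.

(** * Quantitative C^{1,1} maps: composition, time integration, limits *)

Section C11.
Variables (R : realType) (d : nat).
Local Notation V := 'rV[R]_d.

Lemma ebas_norm (i : 'I_d) : `|ebas R i| = 1.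
Proof.
apply/le_anti/andP; split.
  by apply: mx_norm_le => // k j; rewrite mxE; case: (_ && _); rewrite ?normr1 ?normr0.
by have := mx_coord_le (ebas R i) 0 i; rewrite mxE !eqxx normr1.
Qed.

Definition opbound (M : 'M[R]_d) (A : R) : Prop := forall v : V, `|v *m M| <= A * `|v|.

Lemma opbound_coord M A i j : opbound M A -> `|M i j| <= A.
Proof.
move=> /(_ (ebas R i)); rewrite ebas_norm mulr1; apply: le_trans.
by have := mx_coord_le (ebas R i *m M) 0 j; rewrite -rowE mxE.
Qed.

Lemma mulmx_row_sum (v : V) (M : 'M[R]_d) : v *m M = \sum_i v 0 i *: row i M.
Proof.
by apply/rowP => j; rewrite mxE summxE; apply: eq_bigr => i _; rewrite !mxE.
Qed.

Lemma opbound_rows M c : 0 <= c -> (forall i, `|row i M| <= c) -> opbound M (d%:R * c).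
Proof.
move=> c0 h v; rewrite mulmx_row_sum (le_trans (ler_norm_sum _ _ _)) //.
apply: (@le_trans _ _ (\sum_(i < d) c * `|v|)).
  by apply: ler_sum => i _; rewrite normrZ mulrC ler_pM // mx_coord_le.
by rewrite sumr_const card_ord -mulrA mulr_natl.
Qed.

Lemma opboundW M A A' : A <= A' -> opbound M A -> opbound M A'.
Proof. by move=> AA h v; apply: le_trans (h v) _; rewrite ler_wpM2r. Qed.

Lemma opboundM M N A A' : 0 <= A' -> opbound M A -> opbound N A' -> opbound (M *m N) (A' * A).
Proof.
move=> A0 h h' v; rewrite mulmxA (le_trans (h' _)) // -mulrA ler_wpM2l //; exact: h.
Qed.

Lemma opboundD M N A A' : opbound M A -> opbound N A' -> opbound (M + N) (A + A').
Proof.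
by move=> h h' v; rewrite mulmxDr (le_trans (ler_normD _ _)) // mulrDl lerD.
Qed.

(** Transposition exchanges row sums and column sums; in the sup norm this costs a factor [d]. *)
Lemma opbound_tr M A (w : V) : 0 <= A -> opbound M A -> `|w *m M^T| <= d%:R * A * `|w|.
Proof.
move=> A0 h; apply: mx_norm_le => [|i j]; first by rewrite !mulr_ge0.
rewrite mxE (le_trans (ler_norm_sum _ _ _)) //.
apply: (@le_trans _ _ (\sum_(k < d) A * `|w|)).
  apply: ler_sum => k _; rewrite normrM mulrC mxE.
  by rewrite ler_pM ?(opbound_coord _ _ h) // (ord1 i) mx_coord_le.
by rewrite sumr_const card_ord -mulrA mulr_natl.
Qed.

(** Points are row vectors, so [J x] is the transposed Jacobian matrix: row [i] is the i-th partial
    derivative, and [v *m J x] is the derivative in direction [v]. *)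
Record C11 (phi : V -> V) (J : V -> 'M[R]_d) (A L : R) : Prop := C11Build {
  C11_lip : forall x y, `|phi y - phi x| <= A * `|y - x|;
  C11_op : forall x, opbound (J x) A;
  C11_oplip : forall x y, opbound (J y - J x) (L * `|y - x|);
  C11_rem : forall x y, `|phi y - phi x - (y - x) *m J x| <= L * `|y - x| ^+ 2 }.

Lemma C11W phi J A L A' L' : A <= A' -> L <= L' -> C11 phi J A L -> C11 phi J A' L'.
Proof.
move=> AA LL [h1 h2 h3 h4]; split.
- by move=> x y; apply: le_trans (h1 x y) _; rewrite ler_wpM2r.
- by move=> x; apply: opboundW (h2 x).
- by move=> x y; apply: opboundW (h3 x y); rewrite ler_wpM2r.
- by move=> x y; apply: le_trans (h4 x y) _; rewrite ler_wpM2r // exprn_ge0.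
Qed.

Lemma C11_id : C11 id (fun=> 1%:M) 1 1.
Proof.
split=> [x y|x v|x y v|x y]; rewrite ?mul1r ?mulmx1 //.
  by rewrite subrr mulmx0 normr0 mulr_ge0.
by rewrite subrr normr0 exprn_ge0.
Qed.

(** The remainder of the composition is that of [g] along the increment of [phi], which gives
    [K2 A^2], plus [Dg] applied to that of [phi], which gives [K L]. The Lipschitz constant of the
    differential splits in the same way. *)
Lemma C11_comp g Dg K K2 phi J A L : 0 <= K -> 0 <= K2 -> 0 <= A ->
  C11 g Dg K K2 -> C11 phi J A L ->
  C11 (g \o phi) (fun x => J x *m Dg (phi x)) (K * A) (K2 * A ^+ 2 + K * L).
Proof.
move=> K0 K20 A0 [g1 g2 g3 g4] [h1 h2 h3 h4]; split.
- move=> x y; apply: le_trans (g1 _ _) _.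
  by rewrite -mulrA ler_wpM2l.
- by move=> x; exact: opboundM.
- move=> x y v.
  have -> : v *m (J y *m Dg (phi y) - J x *m Dg (phi x)) =
     v *m J y *m (Dg (phi y) - Dg (phi x)) + v *m (J y - J x) *m Dg (phi x).
    by rewrite !mulmxBr !mulmxBl !mulmxA subrKA.
  apply: le_trans (ler_normD _ _) _.
  rewrite !mulrDl lerD //.
    apply: le_trans (g3 _ _ _) _.
    have e1 : K2 * `|phi y - phi x| <= K2 * (A * `|y - x|) by rewrite ler_wpM2l.
    apply: le_trans (ler_pM _ _ e1 (h2 y v)) _; rewrite ?mulr_ge0 //.
    by rewrite le_eqVlt; apply/orP; left; apply/eqP; ring.
  apply: le_trans (g2 _ _) _; rewrite -!mulrA ler_wpM2l //.
  by rewrite mulrA; exact: h3.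
- move=> x y /=.
  have -> : g (phi y) - g (phi x) - (y - x) *m (J x *m Dg (phi x)) =
     (g (phi y) - g (phi x) - (phi y - phi x) *m Dg (phi x)) +
     (phi y - phi x - (y - x) *m J x) *m Dg (phi x).
    rewrite [in RHS](mulmxBl (phi y - phi x)) mulmxA.
    move: (_ *m Dg (phi x)) (_ *m Dg (phi x)) => p q.
    by apply/rowP => i; rewrite !mxE; ring.
  apply: le_trans (ler_normD _ _) _; rewrite !mulrDl lerD //.
    apply: le_trans (g4 _ _) _; rewrite -mulrA ler_wpM2l // -exprMn.
    by rewrite lerXn2r ?nnegrE ?mulr_ge0.
  by apply: le_trans (g2 _ _) _; rewrite -mulrA ler_wpM2l.
Qed.

(** For fixed points each clause of [C11] bounds an expression linear in [(phi, J)]. Its time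
    derivative is the same expression in [(phi', J')], so the mean value inequality integrates the
    clauses one by one. *)
Lemma C11_evolve (a b : R) (phi phi' : R -> V -> V) (J J' : R -> V -> 'M[R]_d)
    (al al' la la' : R -> R) : a <= b ->
  (forall x, mevolves a b (phi^~ x) (phi'^~ x)) ->
  (forall x, mevolves a b (J^~ x) (J'^~ x)) ->
  evolves a b al al' -> evolves a b la la' ->
  (forall t, a < t < b -> C11 (phi' t) (J' t) (al' t) (la' t)) ->
  C11 (phi a) (J a) (al a) (la a) -> C11 (phi b) (J b) (al b) (la b).
Proof.
move=> ab ephi eJ eal ela hC [a1 a2 a3 a4].
have scal c g g' : evolves a b g g' -> evolves a b (fun t => g t * c) (fun t => g' t * c).
  move=> h; under eq_fun do rewrite mulrC.
  under [X in evolves _ _ _ X]eq_fun do rewrite mulrC.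
  exact: evolvesZ.
have fin m n (f f' : R -> 'M[R]_(m, n)) g g' c : mevolves a b f f' -> evolves a b g g' ->
    (forall t, a < t < b -> `|f' t| <= g' t * c) -> `|f a| <= g a * c -> `|f b| <= g b * c.
  move=> ef eg h ha.
  have := mevolves_le ab ef (scal c _ _ eg) h.
  have := lerB_dist (f b) (f a); lra.
split.
- move=> x y; apply: (fin _ _ (fun t => phi t y - phi t x) _ _ _ _ (mevolvesB (ephi y) (ephi x)) eal).
  + by move=> t /hC h; exact: C11_lip h _ _.
  + exact: a1.
- move=> x v; apply: (fin _ _ (fun t => v *m J t x) _ _ _ _ (mevolvesMl v (eJ x)) eal).
  + by move=> t /hC h; exact: C11_op h _ _.
  + exact: a2.
- move=> x y v; rewrite -mulrA.
  apply: (fin _ _ (fun t => v *m (J t y - J t x)) _ _ _ _ (mevolvesMl v (mevolvesB (eJ y) (eJ x))) ela).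
  + by move=> t /hC h; rewrite mulrA; exact: C11_oplip h _ _ _.
  + by rewrite mulrA; exact: a3.
- move=> x y; apply: (fin _ _ (fun t => phi t y - phi t x - (y - x) *m J t x) _ _ _ _
    (mevolvesB (mevolvesB (ephi y) (ephi x)) (mevolvesMl (y - x) (eJ x))) ela).
  + by move=> t /hC h; exact: C11_rem h _ _.
  + exact: a4.
Qed.

(** For fixed points, replacing [(phi, J)] by a pair within [e] changes each inequality by a fixed
    multiple of [e], which then tends to 0; the constants [A] and [L] survive. *)
Lemma C11_limit phi J A L :
  (forall e : R, 0 < e -> exists psi H, [/\ C11 psi H A L,
     forall x, `|phi x - psi x| <= e & forall x, opbound (J x - H x) e]) ->
  C11 phi J A L.
Proof.
move=> hl.
have lim (p q c : R) : 0 <= c -> (forall e, 0 < e -> p <= q + c * e) -> p <= q.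
  move=> c0 h; apply/ler_addgt0Pr => e e0.
  have c1 : 0 < c + 1 by lra.
  apply: le_trans (h (e / (c + 1)) (divr_gt0 e0 c1)) _.
  rewrite lerD2l mulrA ler_pdivrMr // mulrDr mulr1 mulrC; lra.
have tri (u v : V) : `|u| <= `|v| + `|u - v| by rewrite -{1}(subrK v u) addrC ler_normD.
split.
- move=> x y; apply: (lim _ _ 2) => // e /hl [psi [H [[h1 h2 h3 h4] k1 k2]]].
  have := tri (phi y - phi x) (psi y - psi x).
  have -> : phi y - phi x - (psi y - psi x) = (phi y - psi y) - (phi x - psi x).
    by apply/rowP => i; rewrite !mxE; ring.
  have := ler_normB (phi y - psi y) (phi x - psi x).
  have := h1 x y; have := k1 x; have := k1 y; lra.
- move=> x v; apply: (lim _ _ `|v|) => // e /hl [psi [H [[h1 h2 h3 h4] k1 k2]]].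
  have := tri (v *m J x) (v *m H x); rewrite -mulmxBr.
  have := k2 x v; have := h2 x v; lra.
- move=> x y v; apply: (lim _ _ (2 * `|v|)); first by rewrite mulr_ge0.
  move=> e /hl [psi [H [[h1 h2 h3 h4] k1 k2]]].
  have := tri (v *m (J y - J x)) (v *m (H y - H x)); rewrite -mulmxBr.
  have -> : J y - J x - (H y - H x) = (J y - H y) - (J x - H x).
    by apply/matrixP => i j; rewrite !mxE; ring.
  rewrite (mulmxBr v (J y - H y)).
  have := ler_normB (v *m (J y - H y)) (v *m (J x - H x)).
  have := k2 x v; have := k2 y v; have := h3 x y v; lra.
- move=> x y; apply: (lim _ _ (2 + `|y - x|)); first by rewrite addr_ge0.
  move=> e /hl [psi [H [[h1 h2 h3 h4] k1 k2]]].
  have := tri (phi y - phi x - (y - x) *m J x) (psi y - psi x - (y - x) *m H x).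
  have -> : phi y - phi x - (y - x) *m J x - (psi y - psi x - (y - x) *m H x) =
     (phi y - psi y) - (phi x - psi x) - (y - x) *m (J x - H x).
    rewrite mulmxBr; move: (_ *m J x) (_ *m H x) => p q.
    by apply/rowP => i; rewrite !mxE; ring.
  have := ler_normB (phi y - psi y - (phi x - psi x)) ((y - x) *m (J x - H x)).
  have := ler_normB (phi y - psi y) (phi x - psi x).
  have := h4 x y; have := k1 x; have := k1 y; have := k2 x (y - x); lra.
Qed.

End C11.

(** * From C^2 fields to C^{1,1} maps, and pull-back of test fields *)

Section Regularity.
Variables (R : realType) (d : nat).
Local Notation V := 'rV[R]_d.

Lemma C11_is_derive phi J A L x (j : 'I_d) : @C11 R d phi J A L ->
  is_derive x (ebas R j) phi (row j (J x)).
Proof.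
move=> [_ _ _ h4].
have lim : (fun h => h^-1 *: (phi (h *: ebas R j + x) - phi x)) @ 0^' --> row j (J x).
  apply/cvgrPdist_le => e e0.
  have L1 : 0 < `|L| + 1 by rewrite ltr_pwDr.
  near=> h.
  have h0 : h != 0 by near: h; exact: nbhs_dnbhs_neq.
  have hd : `|h| <= e / (`|L| + 1).
    by near: h; apply: dnbhs0_le; exact: divr_gt0.
  have := h4 x (h *: ebas R j + x); rewrite addrK normrZ ebas_norm mulr1.
  rewrite -scalemxAl -rowE => k.
  rewrite distrC (_ : _ - _ = h^-1 *: (phi (h *: ebas R j + x) - phi x - h *: row j (J x))); last first.
    by rewrite [in RHS]scalerBr scalerA mulVf // scale1r.
  rewrite normrZ normfV ler_pdivrMl ?normr_gt0 //.
  apply: (le_trans k); rewrite expr2 mulrCA ler_wpM2l //.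
  move: hd; rewrite ler_pdivlMr // mulrC => hd.
  apply: le_trans hd; rewrite ler_wpM2r //.
  by have := ler_norm L; lra.
apply: DeriveDef; first by apply/cvg_ex; exists (row j (J x)).
exact/cvg_lim.
Unshelve. all: by end_near. Qed.

Lemma is_derive_line (f : V -> V) (z v : V) (t : R) : derivable f (z + t *: v) v ->
  is_derive t 1 (fun s => f (z + s *: v)) ('D_v f (z + t *: v)).
Proof.
have E : (fun h => h^-1 *: (((fun s => f (z + s *: v)) \o shift t) (h *: (1 : R)) - f (z + t *: v))) =
   (fun h => h^-1 *: ((f \o shift (z + t *: v)) (h *: v) - f (z + t *: v))).
  apply/funext => h /=; congr (_ *: (f _ - _)).
  by rewrite scalerDl /GRing.scale /= mulr1 addrCA addrA.
by move=> D; apply: DeriveDef; rewrite /derivable /derive /= E.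
Qed.

(** The coordinates of [x] are replaced by those of [y] one at a time, and the mean value inequality
    is used along each axis. The reference vectors [c] serve two purposes: zero gives a Lipschitz
    bound, the partial derivatives at [x] give a Taylor remainder. *)
Lemma partial_mvt (f : V -> V) (x y : V) (c : 'I_d -> V) (K : R) : 0 <= K ->
  (forall z i, derivable f z (ebas R i)) ->
  (forall z i, `|z - x| <= `|y - x| -> `|'D_(ebas R i) f z - c i| <= K) ->
  `|f y - f x - \sum_i (y - x) 0 i *: c i| <= d%:R * K * `|y - x|.
Proof.
move=> K0 Df Kf.
pose z k : V := \row_j if (j < k)%N then y 0 j else x 0 j.
have z0 : z 0%N = x by apply/rowP => j; rewrite mxE.
have zd : z d = y by apply/rowP => j; rewrite mxE ltn_ord.
have step (k : 'I_d) :
    `|f (z k.+1) - f (z k) - (y - x) 0 k *: c k| <= K * `|y - x|.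
  set s := (y - x) 0 k.
  have zS : z k.+1 = z k + s *: ebas R k.
    apply/rowP => j; rewrite !mxE eqxx /= ltnS leq_eqVlt /s.
    case: (eqVneq j k) => [->|jk]; first by rewrite eqxx ltnn /= !mxE; ring.
    by rewrite -val_eqE in jk; rewrite (negbTE jk) /= !mulr0 addr0.
  have sN : `|s| <= `|y - x| by exact: mx_coord_le.
  (* In the sup norm the whole path stays in the ball around [x] through [y], the only place where
     the partial derivatives are controlled. *)
  have ball t : `|t| <= `|s| -> `|z k + t *: ebas R k - x| <= `|y - x|.
    move=> ts; apply: mx_norm_le => // i j; rewrite !mxE (ord1 i) eqxx /=.
    case: (eqVneq j k) => [->|jk].
      by rewrite ltnn mulr1 addrAC subrr add0r (le_trans ts).
    rewrite mulr0 addr0; case: ifP => _; last by rewrite subrr normr0.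
    by have := mx_coord_le (y - x) 0 j; rewrite !mxE.
  pose h t := f (z k + t *: ebas R k) - t *: c k.
  have hE : f (z k.+1) - f (z k) - s *: c k = h s - h 0.
    by rewrite /h zS !scale0r addr0 subr0 addrAC.
  have ev a b : mevolves a b h (fun t => 'D_(ebas R k) f (z k + t *: ebas R k) - c k).
    apply: mevolvesB.
      move=> i j; apply: evolvesT => t.
      by have := derive_mx_coord (is_derive_line (Df (z k + t *: ebas R k) k)); exact.
    move=> i j; under eq_fun do rewrite mxE mulrC.
    under [X in evolves _ _ _ X]eq_fun do rewrite -[c k i j]mulr1.
    by apply/evolvesZ/evolvesT => t; exact: is_derive_id.
  have lin a b : evolves a b (fun t => K * t) (fun=> K * 1).
    by apply/evolvesZ/evolvesT => t; exact: is_derive_id.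
  rewrite hE; apply: (@le_trans _ _ (K * `|s|)); last by rewrite ler_wpM2l.
  have [s0|/ltW s0] := leP 0 s.
    have := mevolves_le s0 (ev 0 s) (lin 0 s).
    rewrite mulr0 subr0 mulr1 (ger0_norm s0); apply => t /andP[t0 ts].
    by apply/Kf/ball; rewrite !ger0_norm // ltW.
  have := mevolves_le s0 (ev s 0) (lin s 0).
  rewrite mulr0 sub0r mulr1 (ler0_norm s0) distrC mulrN; apply => t /andP[ts t0].
  by apply/Kf/ball; rewrite !ler0_norm ?lerN2 // ltW.
have tele : f y - f x = \sum_(k < d) (f (z k.+1) - f (z k)).
  by rewrite -{1}zd -{1}z0 -(telescope_sumr (fun k => f (z k)) (leq0n d)) big_mkord.
rewrite tele -sumrB (le_trans (ler_norm_sum _ _ _)) //.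
apply: le_trans (ler_sum _ (fun k _ => step k)) _.
by rewrite sumr_const card_ord -mulrA mulr_natl.
Qed.

Definition jac (f : V -> V) (x : V) : 'M[R]_d := \matrix_(i, j) ('D_(ebas R i) f x) 0 j.

Lemma row_jac f x i : row i (jac f x) = 'D_(ebas R i) f x.
Proof. by apply/rowP => j; rewrite !mxE. Qed.

(** [partial_mvt] is used on the partial derivatives, then on [f], then on [f] minus its linear part
    with bound [d K |y - x|]. The constant [(d + 1)^2 K] dominates both [d K] and [d^2 K]. *)
Lemma C2_C11 (f : V -> V) (K : R) : 0 <= K -> C2 f -> C2_bound f K ->
  C11 f (jac f) ((d%:R + 1) ^+ 2 * K) ((d%:R + 1) ^+ 2 * K).
Proof.
move=> K0 [_ hf] hK.
have D0 : 0 <= d%:R :> R by [].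
have DK : 0 <= d%:R * K by rewrite mulr_ge0.
have DDK : 0 <= d%:R * (d%:R * K) by rewrite mulr_ge0.
have DfL x y i : `|'D_(ebas R i) f y - 'D_(ebas R i) f x| <= d%:R * K * `|y - x|.
  have := @partial_mvt ('D_(ebas R i) f) x y (fun=> 0) K K0.
  rewrite big1 ?subr0; last by move=> j _; rewrite scaler0.
  apply=> z j; first by have [_ [_ /(_ j) []]] := hf i.
  by rewrite subr0 => _; have [_ /(_ i j) []] := hK z.
apply: (@C11W _ _ _ _ (d%:R * K) (d%:R * (d%:R * K))).
- nra.
- nra.
split.
- move=> x y; have := @partial_mvt f x y (fun=> 0) K K0.
  rewrite big1 ?subr0; last by move=> j _; rewrite scaler0.
  apply=> z i; first by have [] := hf i.
  by rewrite subr0 => _; have [_ /(_ i i) []] := hK z.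
- move=> x; apply: opbound_rows => // i; rewrite row_jac.
  by have [_ /(_ i i) []] := hK x.
- move=> x y; rewrite -mulrA; apply: opbound_rows; first by rewrite mulr_ge0.
  by move=> i; rewrite raddfB /= !row_jac; exact: DfL.
- move=> x y; rewrite mulmx_row_sum.
  have -> : d%:R * (d%:R * K) * `|y - x| ^+ 2 = d%:R * (d%:R * K * `|y - x|) * `|y - x| by ring.
  under eq_bigr do rewrite row_jac.
  apply: (@partial_mvt f x y (fun i => 'D_(ebas R i) f x)); first by rewrite mulr_ge0.
  + by move=> z i; have [] := hf i.
  + by move=> z i zx; apply: le_trans (DfL _ _ _) _; rewrite ler_wpM2l.
Qed.

Lemma continuous_dominated (W W1 W2 : normedModType R) (f : W -> W1) (g : W -> W2)
    (c1 c2 : R) x : 0 <= c1 -> 0 <= c2 -> {for x, continuous g} ->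
  (forall y, `|f x - f y| <= c1 * `|g x - g y| + c2 * `|x - y|) ->
  {for x, continuous f}.
Proof.
move=> c10 c20 cg h; apply/cvgrPdist_le => e e0.
have p1 : 0 < e / 2 / (c1 + 1) by rewrite !divr_gt0 // ltr_wpDl.
have p2 : 0 < e / 2 / (c2 + 1) by rewrite !divr_gt0 // ltr_wpDl.
near=> y.
have h1 : `|g x - g y| <= e / 2 / (c1 + 1).
  by near: y; apply: cvgr_dist_le => //; exact: cg.
have h2 : `|x - y| <= e / 2 / (c2 + 1).
  by near: y; apply: cvgr_dist_le => //; exact: cvg_id.
apply: le_trans (h y) _.
move: h1 h2; rewrite !ler_pdivlMr ?ltr_wpDl // !mulrDr !mulr1 => h1 h2.
have := normr_ge0 (g x - g y); have := normr_ge0 (x - y); lra.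
Unshelve. all: by end_near. Qed.

Lemma lipschitz_continuous (W W' : normedModType R) (f : W -> W') (c : R) :
  (forall x y, `|f y - f x| <= c * `|y - x|) -> continuous f.
Proof.
move=> h x; apply: (@continuous_dominated _ _ _ f id `|c| 0) => //.
move=> y; rewrite mul0r addr0; apply: le_trans (h _ _) _.
by rewrite ler_wpM2r // ler_norm.
Qed.

(** The push-forward with the differential supplied as data, so that it can be estimated without
    derivatives; [push_C11] identifies it with [push]. *)
Definition pushJ (phi : V -> V) (J : V -> 'M[R]_d) (th : V -> V) : V -> V :=
  fun x => th (phi x) *m (J x)^T.

Lemma push_C11 phi J A L th : @C11 R d phi J A L -> push phi th = pushJ phi J th.
Proof.
move=> h; apply/funext => x; apply/rowP => j; rewrite !mxE.
apply: eq_bigr => i _; have [_ ->] := C11_is_derive x j h.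
by rewrite !mxE.
Qed.

Lemma pushJ_bound phi J A L th M : 0 <= A -> @C11 R d phi J A L ->
  (forall x, `|th x| <= M) -> forall x, `|pushJ phi J th x| <= d%:R * A * M.
Proof.
move=> A0 [_ h2 _ _] hM x; apply: le_trans (opbound_tr _ A0 (h2 x)) _.
by rewrite ler_wpM2l // mulr_ge0.
Qed.

(** The product rule for differences, stated for two maps and two points at once: it yields both the
    modulus of continuity of one pull-back and the distance between the pull-backs by two maps. *)
Lemma pushJ_dist phi J phi' J' A M th x y e1 e2 : 0 <= A -> 0 <= e2 ->
  opbound (J y) A -> (forall z, `|th z| <= M) ->
  `|th (phi y) - th (phi' x)| <= e1 -> opbound (J y - J' x) e2 ->
  `|pushJ phi J th y - pushJ phi' J' th x| <= d%:R * A * e1 + d%:R * e2 * M.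
Proof.
move=> A0 e20 hA hM h1 h2.
have -> : pushJ phi J th y - pushJ phi' J' th x =
    (th (phi y) - th (phi' x)) *m (J y)^T + th (phi' x) *m (J y - J' x)^T.
  rewrite mulmxBl linearB /= mulmxBr /pushJ.
  by rewrite addrA subrK.
apply: le_trans (ler_normD _ _) _; apply: lerD.
  by apply: le_trans (opbound_tr _ A0 hA) _; rewrite ler_wpM2l // mulr_ge0.
by apply: le_trans (opbound_tr _ e20 h2) _; rewrite ler_wpM2l // mulr_ge0.
Qed.

Lemma pushJ_Cb phi J A L th : 0 <= A -> 0 <= L -> @C11 R d phi J A L ->
  Cb th -> Cb (pushJ phi J th).
Proof.
move=> A0 L0 h [ct [M hM]]; split; last first.
  by exists (d%:R * A * M); exact: pushJ_bound h hM.
have cphi := lipschitz_continuous (C11_lip h).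
move=> x; have M0 : 0 <= M by exact: le_trans (hM x).
apply: (@continuous_dominated _ _ _ _ (th \o phi) (d%:R * A) (d%:R * L * M)).
- by rewrite mulr_ge0.
- by rewrite !mulr_ge0.
- by apply: continuous_comp; [exact: cphi|exact: ct].
move=> y; have := @pushJ_dist phi J phi J A M th y x _ (L * `|x - y|) A0
  (mulr_ge0 L0 (normr_ge0 _)) (C11_op h x) hM (lexx _) (C11_oplip h y x).
by rewrite mulrA (mulrAC (d%:R * L)).
Qed.

End Regularity.

(** * Currents, the weak norm and push-forward estimates *)

Section Currents.
Variables (R : realType) (d : nat).
Local Notation V := 'rV[R]_d.
Implicit Types (xi eta zeta : (V -> V) -> R) (th : V -> V).

Lemma Cb_lin (a b : R) th th' : Cb th -> Cb th' -> Cb (fun x => a *: th x + b *: th' x).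
Proof.
move=> [ct [M hM]] [ct' [M' hM']]; split.
  by move=> x; exact: cvgD (cvgZl_tmp (ct x)) (cvgZl_tmp (ct' x)).
exists (`|a| * M + `|b| * M') => x; apply: le_trans (ler_normD _ _) _.
by rewrite !normrZ lerD // ler_wpM2l.
Qed.

Lemma current_bound xi : is_current xi -> exists2 C : R, 0 <= C &
  forall th, Cb th -> forall M, (forall x, `|th x| <= M) -> `|xi th| <= C * M.
Proof.
move=> [_ [C hC]]; exists `|C| => // th c M hM; apply: le_trans (hC th c M hM) _.
by rewrite ler_wpM2r ?ler_norm //; exact: le_trans (hM 0).
Qed.

Lemma currentB xi th th' : is_current xi -> Cb th -> Cb th' ->
  xi (fun x => th x - th' x) = xi th - xi th'.
Proof.
move=> [lin _] c c'; have := lin 1 (-1) th th' c c'.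
rewrite mul1r mulN1r => <-; congr xi; apply/funext => x.
by rewrite scale1r scaleN1r.
Qed.

Lemma cdiff_current xi eta : is_current xi -> is_current eta -> is_current (cdiff xi eta).
Proof.
move=> cx ce; have [C C0 hC] := current_bound cx; have [C' C'0 hC'] := current_bound ce.
split; first by move=> a b th th' c c'; rewrite /cdiff cx.1 // ce.1 //; ring.
exists (C + C') => th c M hM; rewrite mulrDl; apply: le_trans (ler_normB _ _) _.
by rewrite lerD ?hC ?hC'.
Qed.

Lemma lip1_le1 th : lip1 th -> forall x, `|th x| <= 1.
Proof. by move=> [a [b [a0 b0 ab h _]]] x; apply: le_trans (h x) _; lra. Qed.

Lemma lip1_lip th : lip1 th -> forall x y, `|th x - th y| <= `|x - y|.
Proof.
move=> [a [b [a0 b0 ab _ h]]] x y; apply: le_trans (h x y) _.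
by rewrite ler_piMl //; lra.
Qed.

Lemma lip1_Cb th : lip1 th -> Cb th.
Proof.
move=> h; split; last by exists 1; exact: lip1_le1.
by apply: (@lipschitz_continuous _ _ _ _ 1) => x y; rewrite mul1r; exact: lip1_lip.
Qed.

Lemma lip1_0 : lip1 (fun=> 0 : V).
Proof. by exists 0, 0; split => // *; rewrite ?subrr ?normr0 ?mul0r. Qed.

Lemma current0 xi : is_current xi -> xi (fun=> 0) = 0.
Proof.
move=> [lin _]; have := lin 0 0 _ _ (lip1_Cb lip1_0) (lip1_Cb lip1_0).
by rewrite !mul0r addr0 => <-; congr xi; apply/funext => x; rewrite !scaler0 addr0.
Qed.

Lemma le_wnorm xi th : is_current xi -> lip1 th -> xi th <= wnorm xi.
Proof.
move=> cx l; apply: ub_le_sup; last by exists th.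
have [C C0 hC] := current_bound cx; exists C => _ [th' l' <-].
by rewrite (le_trans (ler_norm _)) // -[C]mulr1 hC //; [exact: lip1_Cb|exact: lip1_le1].
Qed.

Lemma wnorm_le xi (c : R) : (forall th, lip1 th -> xi th <= c) -> wnorm xi <= c.
Proof.
move=> h; apply: ge_sup; first by exists (xi (fun=> 0)), (fun=> 0) => //; exact: lip1_0.
by move=> _ [th l <-]; exact: h.
Qed.

Lemma wnorm_ge0 xi : is_current xi -> 0 <= wnorm xi.
Proof. by move=> cx; rewrite -(current0 cx) le_wnorm //; exact: lip1_0. Qed.

Lemma wnorm_triangle xi eta zeta : is_current xi -> is_current eta -> is_current zeta ->
  wnorm (cdiff xi zeta) <= wnorm (cdiff xi eta) + wnorm (cdiff eta zeta).
Proof.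
move=> cx ce cz; apply: wnorm_le => th l.
have := le_wnorm (cdiff_current cx ce) l; have := le_wnorm (cdiff_current ce cz) l.
rewrite /cdiff; lra.
Qed.

Lemma wnormC xi eta : is_current xi -> is_current eta ->
  wnorm (cdiff xi eta) = wnorm (cdiff eta xi).
Proof.
suff le xi' eta' : is_current xi' -> is_current eta' ->
    wnorm (cdiff xi' eta') <= wnorm (cdiff eta' xi').
  by move=> cx ce; apply/le_anti/andP; split; exact: le.
move=> cx ce; apply: wnorm_le => th l.
(* The test ball is symmetric; the opposite field is written as a difference so that [currentB]
   applies. *)
have l' : lip1 (fun x => 0 - th x).
  have [a [b [a0 b0 ab h1 h2]]] := l; exists a, b; split => //.
    by move=> x; rewrite sub0r normrN.
  by move=> x y; rewrite !sub0r -opprD normrN.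
have := le_wnorm (cdiff_current ce cx) l'; rewrite /cdiff.
have c0 := lip1_Cb lip1_0; have ct := lip1_Cb l.
rewrite !currentB // !current0 //; lra.
Qed.

Lemma wnorm_le_dist xi eta : is_current xi -> is_current eta ->
  wnorm xi <= wnorm eta + wnorm (cdiff xi eta).
Proof.
move=> cx ce; apply: wnorm_le => th l.
by have := le_wnorm ce l; have := le_wnorm (cdiff_current cx ce) l; rewrite /cdiff; lra.
Qed.

Lemma wnorm_eq0 xi eta : (forall th, Cb th -> xi th = eta th) ->
  wnorm (cdiff xi eta) <= 0.
Proof. by move=> e; apply: wnorm_le => th /lip1_Cb/e; rewrite /cdiff => ->; rewrite subrr. Qed.

Lemma wnorm_ext xi eta : (forall th, Cb th -> xi th = eta th) -> wnorm xi = wnorm eta.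
Proof.
move=> e; congr sup; apply/seteqP; split => _ [th l <-]; exists th => //.
  by rewrite e //; exact: lip1_Cb.
by rewrite -e //; exact: lip1_Cb.
Qed.

Lemma le_wnorm_scale xi th (a b c : R) : is_current xi -> 0 <= a -> 0 <= b ->
  a + b <= c -> 0 < c -> (forall x, `|th x| <= a) ->
  (forall x y, `|th x - th y| <= b * `|x - y|) -> xi th <= c * wnorm xi.
Proof.
move=> cx a0 b0 abc c0 h1 h2.
have ct : Cb th.
  split; last by exists a.
  exact: (@lipschitz_continuous _ _ _ _ b).
(* The field is rescaled into the test ball; the null second term matches the two-term linearity
   clause of [is_current]. *)
have l : lip1 (fun x => c^-1 *: th x + 0 *: th x).
  exists (c^-1 * a), (c^-1 * b); split.
  - by rewrite mulr_ge0 // invr_ge0 ltW.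
  - by rewrite mulr_ge0 // invr_ge0 ltW.
  - by rewrite -mulrDr mulrC ler_pdivrMr // mul1r.
  - by move=> x; rewrite scale0r addr0 normrZ gtr0_norm ?invr_gt0 // ler_wpM2l // invr_ge0 ltW.
  - move=> x y; rewrite !scale0r !addr0 -scalerBr normrZ gtr0_norm ?invr_gt0 //.
    by rewrite -mulrA ler_wpM2l // invr_ge0 ltW.
have := le_wnorm cx l; rewrite cx.1 // mul0r addr0 mulrC ler_pdivrMr //.
by rewrite mulrC.
Qed.

Definition pushC (xi : (V -> V) -> R) (phi : V -> V) (J : V -> 'M[R]_d) : (V -> V) -> R :=
  fun th => xi (pushJ phi J th).

Lemma pushC_current xi phi J A L : is_current xi -> 0 <= A -> 0 <= L ->
  C11 phi J A L -> is_current (pushC xi phi J).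
Proof.
move=> cx A0 L0 h; have [C C0 hC] := current_bound cx; split.
  move=> a b th th' c c'; rewrite /pushC -cx.1; try exact: (pushJ_Cb A0 L0 h).
  by congr xi; apply/funext => x; rewrite /pushJ mulmxDl -!scalemxAl.
exists (C * (d%:R * A)) => th c M hM; rewrite -mulrA.
by apply: hC; [exact: (pushJ_Cb A0 L0 h)|exact: pushJ_bound h hM].
Qed.

(** Only the strong norm [C] and the first-order constant [A] enter the bound. This is why the
    restart time in [sol_extend] depends on these two quantities alone. *)
Lemma wnorm_pushC xi phi J A L (C : R) : 0 <= C -> 0 <= A -> 0 <= L ->
  (forall th, Cb th -> forall M, (forall x, `|th x| <= M) -> `|xi th| <= C * M) ->
  C11 phi J A L -> wnorm (pushC xi phi J) <= C * (d%:R * A).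
Proof.
move=> C0 A0 L0 hC h; apply: wnorm_le => th l; rewrite (le_trans (ler_norm _)) //.
apply: hC; first exact/(pushJ_Cb A0 L0 h)/lip1_Cb.
by move=> x; have := pushJ_bound A0 h (lip1_le1 l) x; rewrite mulr1.
Qed.

(** Test fields in the weak norm are Lipschitz, so uniformly close pairs [(phi, J)] give uniformly
    close pull-backs. This makes the coupled system Lipschitz. *)
Lemma wnorm_pushC_dist xi phi J phi' J' A L (C e : R) : is_current xi ->
  0 <= C -> 0 <= A -> 0 <= L -> 0 <= e ->
  (forall th, Cb th -> forall M, (forall x, `|th x| <= M) -> `|xi th| <= C * M) ->
  C11 phi J A L -> C11 phi' J' A L ->
  (forall x, `|phi x - phi' x| <= e) -> (forall x, opbound (J x - J' x) e) ->
  wnorm (cdiff (pushC xi phi J) (pushC xi phi' J')) <= C * (d%:R * (A + 1)) * e.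
Proof.
move=> cx C0 A0 L0 e0 hC h h' e1 e2; apply: wnorm_le => th l.
have ct := lip1_Cb l.
have p := pushJ_Cb A0 L0 h ct; have p' := pushJ_Cb A0 L0 h' ct.
rewrite /cdiff /pushC -currentB // (le_trans (ler_norm _)) // -mulrA.
apply: hC.
  have := Cb_lin 1 (-1) p p'; congr Cb; apply/funext => x.
  by rewrite scale1r scaleN1r.
move=> x; rewrite (_ : _ * e = d%:R * A * e + d%:R * e * 1); last by ring.
apply: (pushJ_dist A0 e0 (C11_op h x) (lip1_le1 l)) => //.
exact: le_trans (lip1_lip l _ _) (e1 x).
Qed.

(** The pull-back of a test field is bounded by [d A] and has Lipschitz constant at most
    [d A^2 + d L], hence is a multiple of a test field. The result is linear in the weak norm, as
    the bootstrap requires. *)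
Lemma wnorm_pushC_le xi phi J A L : is_current xi -> 0 <= A -> 0 <= L ->
  C11 phi J A L -> wnorm (pushC xi phi J) <= ((d%:R + 1) * (A + A ^+ 2 + L + 1)) * wnorm xi.
Proof.
move=> cx A0 L0 h; apply: wnorm_le => th l.
have D0 : 0 <= d%:R :> R by [].
have A2 : 0 <= A ^+ 2 by rewrite exprn_ge0.
rewrite /pushC; apply: (@le_wnorm_scale _ _ (d%:R * A * 1) (d%:R * A * A + d%:R * L * 1)) => //.
- by rewrite !mulr_ge0.
- by rewrite addr_ge0 // !mulr_ge0.
- move: A2; rewrite expr2; nra.
- by rewrite mulr_gt0 //; lra.
- by move=> x; exact: pushJ_bound h (lip1_le1 l) x.
- move=> y x; rewrite mulrDl.
  have := @pushJ_dist _ _ phi J phi J A 1 th x y (A * `|y - x|) (L * `|y - x|) A0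
    (mulr_ge0 L0 (normr_ge0 _)) (C11_op h y) (lip1_le1 l) _ (C11_oplip h x y).
  rewrite !mulr1 !mulrA; apply.
  by apply: le_trans (lip1_lip l _ _) _; exact: C11_lip h _ _.
Qed.

End Currents.

(** * Existence for the coupled system of flow and differential *)

Section Flow.
Variables (R : realType) (d : nat).
Local Notation V := 'rV[R]_d.
Variables (B : ((V -> V) -> R) -> V -> V) (CB : R).
Hypothesis hB : standing B CB.

(** The C^{1,1} constant given by [C2_C11] for a velocity field generated by a current of weak norm
    at most [m]. *)
Definition Kfield (m : R) : R := (d%:R + 1) ^+ 2 * (CB * (m + 1)).

Lemma CB_gt0 : 0 < CB. Proof. by case: hB. Qed.

Lemma Kfield_gt0 m : 0 <= m -> 0 < Kfield m.
Proof.
move=> m0; have := CB_gt0 => C0; have D0 : 0 <= d%:R :> R by [].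
by rewrite !mulr_gt0 ?exprn_gt0 //; lra.
Qed.

Lemma field_C11 xi m : is_current xi -> wnorm xi <= m ->
  C11 (B xi) (jac (B xi)) (Kfield m) (Kfield m).
Proof.
move=> cx xm; have [C0 [hC2 [_ [hK _]]]] := hB.
have w0 := wnorm_ge0 cx.
have le : (d%:R + 1) ^+ 2 * (CB * (wnorm xi + 1)) <= Kfield m.
  by rewrite ler_wpM2l ?exprn_ge0 ?addr_ge0 // ler_wpM2l ?(ltW C0) //; lra.
apply: (C11W le le); apply: C2_C11 (hC2 _ cx) (hK _ cx).
by rewrite mulr_ge0 ?(ltW C0) //; lra.
Qed.

Lemma field_bound xi m x : is_current xi -> wnorm xi <= m -> `|B xi x| <= Kfield m.
Proof.
move=> cx xm; have [C0 [_ [_ [hK _]]]] := hB.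
have w0 := wnorm_ge0 cx; have D0 : 0 <= d%:R :> R by [].
have [h _] := hK _ cx x; apply: le_trans h _.
apply: (@le_trans _ _ (CB * (m + 1))); first by rewrite ler_wpM2l ?(ltW C0) //; lra.
rewrite /Kfield ler_peMl //; first by rewrite mulr_ge0 ?(ltW C0) //; lra.
by rewrite expr2; nra.
Qed.

Lemma field_dist xi eta w x : is_current xi -> is_current eta ->
  wnorm (cdiff xi eta) <= w ->
  `|B xi x - B eta x| <= CB * w /\
  opbound (jac (B xi) x - jac (B eta) x) (d%:R * (CB * w)).
Proof.
move=> cx ce xew; have [C0 [_ [_ [_ [h1 h2]]]]] := hB.
have le : CB * wnorm (cdiff xi eta) <= CB * w by rewrite ler_wpM2l // ltW.
split; first exact: le_trans (h1 _ _ cx ce x) le.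
apply: opbound_rows.
  by apply: le_trans le; rewrite mulr_ge0 ?(ltW C0) // wnorm_ge0 //; exact: cdiff_current.
by move=> i; rewrite raddfB /= !row_jac; exact: le_trans (h2 _ _ cx ce x i) le.
Qed.

(** A Lipschitz constant for the right-hand side of the coupled system, for currents of weak norm at
    most [m] and differentials bounded by [A]. *)
Definition Nfield (m A : R) : R := (A + 1) * ((d%:R + 1) * CB + Kfield m).

Lemma Nfield_ge0 m A : 0 <= m -> 0 <= A -> 0 <= Nfield m A.
Proof.
move=> m0 A0; have k := Kfield_gt0 m0; have C0 := CB_gt0.
by rewrite mulr_ge0 ?addr_ge0 ?(ltW k) // mulr_ge0 ?addr_ge0 // ltW.
Qed.

Lemma system_dist xi eta m w e A (p q : V) (P Q : 'M[R]_d) :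
  is_current xi -> is_current eta -> wnorm xi <= m ->
  wnorm (cdiff xi eta) <= w -> wnorm eta <= m ->
  0 <= A -> opbound Q A -> 0 <= e -> `|p - q| <= e -> opbound (P - Q) e ->
  `|B xi p - B eta q| <= Nfield m A * (w + e) /\
  opbound (P *m jac (B xi) p - Q *m jac (B eta) q) (Nfield m A * (w + e)).
Proof.
move=> cx ce xm xew em A0 hQ e0 pq PQ.
have m0 : 0 <= m by exact: le_trans (wnorm_ge0 cx) xm.
have k0 := Kfield_gt0 m0; have C0 := CB_gt0; have D0 : 0 <= d%:R :> R by [].
have w0 : 0 <= w by apply: le_trans xew; apply: wnorm_ge0; exact: cdiff_current.
have [x1 x2 x3 x4] := field_C11 cx xm.
have [y1 y2 y3 y4] := field_C11 ce em.
have [f1 f2] := field_dist p cx ce xew.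
have Kpq : Kfield m * `|p - q| <= Kfield m * e by rewrite ler_wpM2l // ltW.
have CBw : 0 <= CB * w by rewrite mulr_ge0 // ltW.
have CBe : 0 <= CB * e by rewrite mulr_ge0 // ltW.
have Kw : 0 <= Kfield m * w by rewrite mulr_ge0 // ltW.
have Ke : 0 <= Kfield m * e by rewrite mulr_ge0 // ltW.
have dCBw : 0 <= d%:R * (CB * w) by rewrite mulr_ge0.
have dCBe : 0 <= d%:R * (CB * e) by rewrite mulr_ge0.
(* All products that occur are collected in [s], so that [Nfield m A * (w + e)] becomes [s + A * s]
   and the remaining comparisons are linear. *)
pose s := d%:R * (CB * w) + CB * w + d%:R * (CB * e) + CB * e + Kfield m * w + Kfield m * e.
have NE : Nfield m A * (w + e) = s + A * s by rewrite /Nfield /s; ring.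
have As : 0 <= A * s by rewrite mulr_ge0 // /s; lra.
split.
  have := ler_distD (B eta p) (B xi p) (B eta q); have := y1 q p.
  by rewrite NE; move: As; rewrite {2}/s; lra.
(* Three changes are made in turn: of the differential, of the current, of the base point. *)
have E : P *m jac (B xi) p - Q *m jac (B eta) q = (P - Q) *m jac (B xi) p +
   Q *m ((jac (B xi) p - jac (B eta) p) + (jac (B eta) p - jac (B eta) q)).
  by rewrite addrA subrK mulmxBl mulmxBr addrA subrK.
rewrite E; apply: opboundW (opboundD (opboundM (ltW k0) PQ (x2 p))
  (opboundM _ hQ (opboundD f2 (y3 q p)))); last by rewrite addr_ge0 // mulr_ge0 // ltW.
rewrite NE; apply: lerD; first by rewrite /s; lra.
by rewrite mulrC ler_wpM2l // /s; lra.
Qed.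

(* A pair (map, differential) flattened into real coordinates, so that [picard] only has to
   deal with real-valued unknowns; the index [None] is for the map, [Some i] for its i-th
   partial derivative. *)
Definition state : Type := V * option 'I_d * 'I_d -> R.
Definition state_map (u : state) (x : V) : V := \row_j u (x, None, j).
Definition state_jac (u : state) (x : V) : 'M[R]_d := \matrix_(i, j) u (x, Some i, j).
Definition mk_state (phi : V -> V) (J : V -> 'M[R]_d) : state :=
  fun z => if z.1.2 is Some i then J z.1.1 i z.2 else phi z.1.1 0 z.2.

Lemma state_mapK phi J : state_map (mk_state phi J) = phi.
Proof. by apply/funext => x; apply/rowP => j; rewrite mxE. Qed.

Lemma state_jacK phi J : state_jac (mk_state phi J) = J.
Proof. by apply/funext => x; apply/matrixP => i j; rewrite mxE. Qed.

Lemma state_dist (u v : state) (e : R) : 0 <= e -> (forall z, `|u z - v z| <= e) ->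
  (forall x, `|state_map u x - state_map v x| <= (d%:R + 1) * e) /\
  (forall x, opbound (state_jac u x - state_jac v x) ((d%:R + 1) * e)).
Proof.
move=> e0 h; have D0 : 0 <= d%:R * e by rewrite mulr_ge0.
split=> x.
  apply: (@le_trans _ _ e); last lra.
  by apply: mx_norm_le => // i j; rewrite !mxE.
apply: (@opboundW _ _ _ (d%:R * e)); first lra.
by apply: opbound_rows => // i; apply: mx_norm_le => // k j; rewrite !mxE.
Qed.

Section Existence.
Variables (a b A L m Lz : R) (psi : V -> V) (J0 : V -> 'M[R]_d).
Variable zeta : R -> (V -> V) -> (V -> 'M[R]_d) -> (V -> V) -> R.
Let k := Kfield m.
(** These constants solve [cA' = k cA] and [cL' = 2 k cL]. The rate [2 k] absorbs the constant
    [k cA^2 + k cL] of a composition with the field, because [A^2 <= L] propagates to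
    [cA^2 <= cL]. *)
Let cA t := A * expR (k * (t - a)).
Let cL t := L * expR ((2 * k) * (t - a)).
Hypotheses (ab : a <= b) (A0 : 0 <= A) (AL : A ^+ 2 <= L) (m0 : 0 <= m) (Lz0 : 0 <= Lz).
Hypothesis hpsi : C11 psi J0 A L.
Hypothesis zeta_current : forall t phi J, a <= t <= b -> C11 phi J (cA b) (cL b) ->
  is_current (zeta t phi J) /\ wnorm (zeta t phi J) <= m.
Hypothesis zeta_lip : forall t phi J phi' J' (e : R), a <= t <= b -> 0 <= e ->
  C11 phi J (cA b) (cL b) -> C11 phi' J' (cA b) (cL b) ->
  (forall x, `|phi x - phi' x| <= e) -> (forall x, opbound (J x - J' x) e) ->
  wnorm (cdiff (zeta t phi J) (zeta t phi' J')) <= Lz * e.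
Hypothesis zeta_cont : forall t (e : R), a <= t <= b -> 0 < e -> exists2 dt : R, 0 < dt &
  forall s phi J, a <= s <= b -> `|s - t| < dt -> C11 phi J (cA b) (cL b) ->
    wnorm (cdiff (zeta s phi J) (zeta t phi J)) <= e.

Let S t (u : state) := C11 (state_map u) (state_jac u) (cA t) (cL t).
Let curr t (u : state) := zeta t (state_map u) (state_jac u).
Let F t (u : state) : state :=
  mk_state (fun x => B (curr t u) (state_map u x))
           (fun x => state_jac u x *m jac (B (curr t u)) (state_map u x)).
Let M := k + k * cA b.
Let N := Nfield m (cA b).

Let k0 : 0 < k. Proof. exact: Kfield_gt0. Qed.
Let L0 : 0 <= L. Proof. by apply: le_trans AL; rewrite exprn_ge0. Qed.
Let cA0 t : 0 <= cA t. Proof. by rewrite mulr_ge0 // expR_ge0. Qed.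
Let M0 : 0 <= M.
Proof.
have h : 0 <= k * cA b by apply: mulr_ge0; [exact: ltW k0|exact: cA0].
exact: addr_ge0 (ltW k0) h.
Qed.
Let N0 : 0 <= N. Proof. by apply: Nfield_ge0; [exact: m0|exact: cA0]. Qed.

Let cAm s t : s <= t -> cA s <= cA t.
Proof.
move=> st; apply: ler_wpM2l => //; rewrite ler_expR; apply: ler_wpM2l; first exact: ltW.
exact: lerB.
Qed.
Let cLm s t : s <= t -> cL s <= cL t.
Proof.
move=> st; apply: ler_wpM2l; first exact: L0.
rewrite ler_expR; apply: ler_wpM2l; last exact: lerB.
by apply: mulr_ge0 => //; exact: ltW.
Qed.

Let Sb t u : a <= t <= b -> S t u -> C11 (state_map u) (state_jac u) (cA b) (cL b).
Proof. by move=> /andP[_ tb]; apply: C11W; [exact: cAm|exact: cLm]. Qed.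

(** The triangle inequality passes through the current at time [t] and state [u]. Equal times give
    the Lipschitz property of [F], equal moduli along a trajectory its continuity in time. *)
Let F_dist s t u v (e e1 : R) : a <= s <= b -> a <= t <= b -> S s u -> S t v -> 0 <= e ->
  (forall z, `|u z - v z| <= e) ->
  wnorm (cdiff (zeta s (state_map u) (state_jac u)) (zeta t (state_map u) (state_jac u))) <= e1 ->
  forall z, `|F s u z - F t v z| <= N * (e1 + (Lz + 1) * ((d%:R + 1) * e)).
Proof.
move=> sab tab Su Sv e0 uv h1 [[x o] j].
have [d1 d2] := state_dist e0 uv.
have e'0 : 0 <= (d%:R + 1) * e by rewrite mulr_ge0 // addr_ge0.
have Cu := Sb sab Su; have Cv := Sb tab Sv.
have [cs ws] := zeta_current sab Cu; have [ct wt] := zeta_current tab Cu.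
have [cv wv] := zeta_current tab Cv.
have w : wnorm (cdiff (curr s u) (curr t v)) <= e1 + Lz * ((d%:R + 1) * e).
  by apply: le_trans (wnorm_triangle cs ct cv) _; apply: lerD => //; exact: zeta_lip.
have [g1 g2] := system_dist cs cv ws w wv (cA0 b) (C11_op Cv x) e'0 (d1 x) (d2 x).
have <- : e1 + Lz * ((d%:R + 1) * e) + (d%:R + 1) * e = e1 + (Lz + 1) * ((d%:R + 1) * e) by ring.
rewrite /F /mk_state /=; case: o => [i|].
  by have := opbound_coord i j g2; rewrite !mxE.
by apply: le_trans g1; rewrite (le_trans _ (mx_coord_le _ 0 j)) // !mxE.
Qed.

(** The current [zeta] may depend on time and on the pair. A prescribed curve of currents gives a
    linear-type flow ([fixed_flow]); the push-forward of [xi0] gives the nonlinear problem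
    ([sol_extend]). *)
Lemma flow_exists : exists (phi : R -> V -> V) (J : R -> V -> 'M[R]_d),
  [/\ phi a = psi /\ J a = J0,
      forall t, a <= t <= b -> C11 (phi t) (J t) (cA t) (cL t),
      forall x, mevolves a b (phi^~ x) (fun t => B (zeta t (phi t) (J t)) (phi t x)),
      forall x, mevolves a b (J^~ x)
        (fun t => J t x *m jac (B (zeta t (phi t) (J t))) (phi t x)) &
      exists2 C : R, 0 <= C & forall s t x, a <= s <= b -> a <= t <= b ->
        `|phi s x - phi t x| <= C * `|s - t| /\ opbound (J s x - J t x) (C * `|s - t|)].
Proof.
have LF0 : 0 < N * (Lz + 1) * (d%:R + 1) + 1.
  have h : 0 <= N * (Lz + 1) by apply: mulr_ge0; [exact: N0|exact: addr_ge0].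
  have h' : 0 <= N * (Lz + 1) * (d%:R + 1) by apply: mulr_ge0 => //; exact: addr_ge0.
  lra.
have S0 t : a <= t <= b -> S t (mk_state psi J0).
  move=> /andP[at_ _]; rewrite /S state_mapK state_jacK; apply: C11W hpsi.
    rewrite ler_peMr // -expR0 ler_expR; apply: mulr_ge0; first exact: ltW.
    by rewrite subr_ge0.
  rewrite ler_peMr // -expR0 ler_expR; apply: mulr_ge0; last by rewrite subr_ge0.
  by apply: mulr_ge0 => //; exact: ltW.
have FM t u z : a <= t <= b -> S t u -> `|F t u z| <= M.
  move=> tab Su; have Cu := Sb tab Su; have [cu wu] := zeta_current tab Cu.
  have kc : 0 <= k * cA b by apply: mulr_ge0; [exact: ltW|exact: cA0].
  case: z => [[x o] j]; rewrite /F /mk_state /=; case: o => [i|].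
    have := opbound_coord i j (opboundM (ltW k0) (C11_op Cu x)
      (C11_op (field_C11 cu wu) (state_map u x))).
    by move/le_trans; apply; rewrite /M lerDr ltW.
  apply: le_trans (mx_coord_le _ 0 j) _.
  by apply: le_trans (field_bound _ cu wu) _; rewrite /M lerDl.
have FL t u v (e : R) : a <= t <= b -> S t u -> S t v -> (forall z, `|u z - v z| <= e) ->
    forall z, `|F t u z - F t v z| <= (N * (Lz + 1) * (d%:R + 1) + 1) * e.
  move=> tab Su Sv uv z.
  have e0 : 0 <= e by exact: le_trans (uv z).
  have h1 : wnorm (cdiff (zeta t (state_map u) (state_jac u))
      (zeta t (state_map u) (state_jac u))) <= 0 by exact: wnorm_eq0.
  have := F_dist tab tab Su Sv e0 uv h1 z; rewrite add0r; lra.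
have Fcont u z : trajectory a b M S u ->
    continuous (fun s => F (clamp a b s) (u (clamp a b s)) z).
  move=> [Su Lu] t; apply/cvgrPdist_le => e e0.
  pose c := N * ((Lz + 1) * ((d%:R + 1) * M)).
  have c0 : 0 <= c.
    apply: mulr_ge0; first exact: N0.
    apply: mulr_ge0; first exact: addr_ge0.
    by apply: mulr_ge0; [exact: addr_ge0|exact: M0].
  have tab := clamp_bounds t ab.
  have N1 : 0 < N + 1 by have := N0; lra.
  have c1 : 0 < c + 1 by lra.
  have p1 : 0 < e / 2 / (N + 1) by apply: divr_gt0 => //; exact: divr_gt0.
  have p2 : 0 < e / 2 / (c + 1) by apply: divr_gt0 => //; exact: divr_gt0.
  have [dt dt0 hdt] := zeta_cont tab p1.
  near=> s.
  have sab := clamp_bounds s ab.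
  have st : `|t - s| < dt by near: s; apply: cvgr_dist_lt => //; exact: cvg_id.
  have st2 : `|t - s| <= e / 2 / (c + 1).
    by near: s; apply: cvgr_dist_le => //; exact: cvg_id.
  have cl := clamp_lipschitz a b s t; rewrite (distrC s) in cl.
  have Cs := Sb sab (Su _ sab).
  have h1 := hdt _ _ _ sab (le_lt_trans cl st) Cs.
  have h2 z' : `|u (clamp a b s) z' - u (clamp a b t) z'| <= M * `|t - s|.
    by apply: le_trans (Lu _ _ sab tab z') _; exact: ler_wpM2l.
  rewrite distrC.
  apply: le_trans (F_dist sab tab (Su _ sab) (Su _ tab) _ h2 h1 z) _; first exact: mulr_ge0.
  have -> : N * (e / 2 / (N + 1) + (Lz + 1) * ((d%:R + 1) * (M * `|t - s|))) =
     N * (e / 2 / (N + 1)) + c * `|t - s| by rewrite /c; ring.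
  have q1 : N * (e / 2 / (N + 1)) <= e / 2.
    rewrite mulrA ler_pdivrMr // mulrC; apply: ler_wpM2l; lra.
  move: st2; rewrite ler_pdivlMr // mulrDr mulr1.
  have := normr_ge0 (t - s); lra.
have Sstep u w : trajectory a b M S u -> picard_step a b F (mk_state psi J0) u w ->
    forall t, a <= t <= b -> S t (w t).
  move=> [Su _] [wa ew] t /andP[at_ tb].
  (* The velocity of a Picard iterate is the field composed with the previous map; composition
     bounds it and [C11_evolve] integrates the bound. *)
  pose phi' s x := B (curr s (u s)) (state_map (u s) x).
  pose J' s x := state_jac (u s) x *m jac (B (curr s (u s))) (state_map (u s) x).
  apply: (@C11_evolve _ _ a t (fun s => state_map (w s)) phi' (fun s => state_jac (w s)) J'
    cA (fun s => A * (k * expR (k * (s - a)))) cL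
    (fun s => L * ((2 * k) * expR ((2 * k) * (s - a)))) at_).
  - move=> x i j; under eq_fun do rewrite mxE.
    by have := evolves_sub (lexx a) tb (ew (x, None, j)); rewrite (ord1 i).
  - move=> x i j; under eq_fun do rewrite mxE.
    by have := evolves_sub (lexx a) tb (ew (x, Some i, j)).
  - exact: evolves_exp.
  - exact: evolves_exp.
  - move=> s /andP[/ltW as_ /ltW st].
    have sab : a <= s <= b by rewrite as_ (le_trans st tb).
    have Cu := Sb sab (Su _ sab); have [cu wu] := zeta_current sab Cu.
    apply: C11W (C11_comp (ltW k0) (ltW k0) (cA0 s) (field_C11 cu wu) (Su _ sab)).
      by rewrite /cA -/k mulrCA.
    have -> : (2 * k) * (s - a) = k * (s - a) + k * (s - a) by ring.
    rewrite -/k /cA /cL exprMn.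
    have -> : (2 * k) * (s - a) = k * (s - a) + k * (s - a) by ring.
    rewrite expRD -expr2 -mulrDr [leRHS]mulrCA [2 * k]mulrC -[leRHS]mulrA.
    rewrite ler_wpM2l ?(ltW k0) //.
    have q : 0 <= expR (k * (s - a)) ^+ 2 by rewrite exprn_ge0 ?expR_ge0.
    have := ler_wpM2r q AL; lra.
  - by rewrite wa state_mapK state_jacK /cA /cL subrr !mulr0 expR0 !mulr1.
have Sclosed t u : a <= t <= b ->
    (forall e : R, 0 < e -> exists v, S t v /\ forall z, `|u z - v z| <= e) -> S t u.
  move=> tab h; apply: C11_limit => e e0.
  have D1 : 0 < d%:R + 1 :> R by rewrite ltr_wpDl.
  have e1 : 0 < e / (d%:R + 1) by rewrite divr_gt0.
  have [v [Sv hv]] := h _ e1.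
  have [d1 d2] := state_dist (ltW e1) hv.
  have E : (d%:R + 1) * (e / (d%:R + 1)) = e by field; rewrite gt_eqF.
  by exists (state_map v), (state_jac v); split => // x; rewrite -E.
have [u [[Su Lu] ua eu]] := picard ab LF0 M0 S0 FM FL Fcont Sstep Sclosed.
exists (fun t => state_map (u t)), (fun t => state_jac (u t)); split.
- by rewrite ua state_mapK state_jacK.
- exact: Su.
- move=> x i j; under eq_fun do rewrite mxE.
  by have := eu (x, None, j); rewrite (ord1 i).
- move=> x i j; under eq_fun do rewrite mxE.
  exact: eu (x, Some i, j).
- exists ((d%:R + 1) * M); first by apply: mulr_ge0; [exact: addr_ge0|exact: M0].
  move=> s t x sab tab; rewrite -mulrA.
  have [d1 d2] := state_dist (mulr_ge0 M0 (normr_ge0 _)) (Lu _ _ sab tab).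
  by split.
Unshelve. all: by end_near. Qed.

End Existence.
End Flow.

(** * Gluing evolutions at a time *)

Section Gluing.
Variable R : realType.

Lemma evolves_eq (a b : R) (f g f' : R -> R) : (forall t, a <= t <= b -> f t = g t) ->
  evolves a b f f' -> evolves a b g f'.
Proof.
move=> e [cf df]; split.
  apply: subspace_eq_continuous cf => t; rewrite inE /= in_itv /=; exact: e.
move=> t tab; apply: near_eq_is_derive (df t tab).
have /andP[at_ tb] := tab; near=> s; apply: e; apply/andP; split; near: s.
  exact: lt_le_nbhsr at_.
exact: lt_le_nbhsl tb.
Unshelve. all: by end_near. Qed.

(** Nothing is assumed on the derivative of [f] at [c]. The difference of [f] and a primitive of the
    continuous function [f'] is constant on each side, hence everywhere, and the primitive is
    differentiable across [c]. *)
Lemma evolves_glue (a c b : R) (f f' : R -> R) : a <= c -> c <= b ->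
  continuous (fun t => f' (clamp a b t)) ->
  evolves a c f f' -> evolves c b f f' -> evolves a b f f'.
Proof.
move=> ac cb cf' e1 e2.
have [W [Wa dW]] := continuous_primitive a cf'.
have eW : evolves a b W f'.
  apply: (@evolves_ext _ _ _ _ (fun t => f' (clamp a b t))).
    by move=> t /andP[/ltW at_ /ltW tb]; rewrite clamp_id // at_ tb.
  by apply: evolvesI => t /andP[at_ _]; exact: dW.
have const p q : a <= p -> p <= q -> q <= b -> evolves p q f f' -> f q - W q = f p - W p.
  move=> ap pq qb ef; apply/eqP; rewrite -subr_eq0 -normr_le0.
  have := evolves_le pq (evolvesB ef (evolves_sub ap qb eW)) (evolves_cst p q 0).
  by rewrite subrr; apply=> t _; rewrite subrr normr0.
have eqW t : a <= t <= b -> W t - (- f a) = f t.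
  move=> /andP[at_ tb]; rewrite opprK; have [tc|/ltW ct] := leP t c.
    by have := const a t (lexx a) at_ tb (evolves_sub (lexx a) tc e1); rewrite Wa; lra.
  have := const a c (lexx a) ac cb e1; have := const c t ac ct tb (evolves_sub (lexx c) tb e2).
  by rewrite Wa; lra.
apply: (evolves_eq eqW); apply: (@evolves_ext _ _ _ _ (fun t => f' t - 0)).
  by move=> t _; rewrite subr0.
exact: evolvesB eW (evolves_cst _ _ _).
Qed.

End Gluing.

(** * Regularity and uniqueness of solutions *)

Section Solutions.
Variables (R : realType) (d : nat).
Local Notation V := 'rV[R]_d.

Lemma halving (P : R -> Prop) (C : R) : (forall C, P C -> P (C / 2)) -> P C ->
  forall n, P (C / 2 ^+ n).
Proof.
move=> h PC; elim=> [|n IH]; first by rewrite expr0 divr1.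
by rewrite exprSr invfM mulrA; exact: h.
Qed.

(* Gronwall by iteration: a bound [C e^(2k(t-a))] on the difference improves itself to
   [C/2 e^(2k(t-a))]. *)
Lemma ode_unique (a b k : R) (g : R -> V -> V) (p q : R -> V) : a <= b -> 0 < k ->
  (forall t x, a <= t <= b -> `|g t x| <= k) ->
  (forall t x y, a <= t <= b -> `|g t x - g t y| <= k * `|x - y|) ->
  mevolves a b p (fun t => g t (p t)) -> mevolves a b q (fun t => g t (q t)) ->
  p a = q a -> forall t, a <= t <= b -> p t = q t.
Proof.
move=> ab k0 gk gL ep eq pq.
pose P C := forall t, a <= t <= b -> `|p t - q t| <= C * expR (2 * k * (t - a)).
have step C : P C -> P (C / 2).
  move=> hC t /andP[at_ tb].
  have C0 : 0 <= C.
    have := hC a; rewrite lexx ab subrr mulr0 expR0 mulr1 => /(_ isT).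
    exact: le_trans.
  have := @mevolves_le _ _ _ a t _ _ _ _ at_
    (mevolvesB (mevolves_sub (lexx _) tb ep) (mevolves_sub (lexx _) tb eq))
    (evolves_exp a t (2 * k) (C / 2)).
  rewrite pq subrr subr0 => /(_ _)/le_trans; apply.
    move=> s /andP[/ltW as_ /ltW st].
    have sab : a <= s <= b by rewrite as_ (le_trans st tb).
    apply: le_trans (gL _ _ _ sab) _.
    apply: (@le_trans _ _ (k * (C * expR (2 * k * (s - a))))).
      by rewrite ler_wpM2l ?hC // ltW.
    by rewrite le_eqVlt; apply/orP; left; apply/eqP; field.
  rewrite subrr mulr0 expR0 mulr1; lra.
have P0 : P (2 * k * (b - a)).
  move=> t /andP[at_ tb].
  have lin : evolves a t (fun s => 2 * k * s) (fun=> 2 * k * 1).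
    by apply/evolvesZ/evolvesT => s; exact: is_derive_id.
  have := @mevolves_le _ _ _ a t _ _ _ _ at_
    (mevolvesB (mevolves_sub (lexx _) tb ep) (mevolves_sub (lexx _) tb eq)) lin.
  rewrite pq subrr subr0 => /(_ _)/le_trans; apply.
    move=> s /andP[/ltW as_ /ltW st].
    have sab : a <= s <= b by rewrite as_ (le_trans st tb).
    have := ler_normB (g s (p s)) (g s (q s)).
    by have := gk s (p s) sab; have := gk s (q s) sab; lra.
  have k2 : 0 <= 2 * k by lra.
  rewrite -mulrBr -[leLHS]mulr1; apply: ler_pM => //.
  - by rewrite mulr_ge0 ?subr_ge0.
  - by rewrite ler_wpM2l // lerB.
  - by apply: le_trans (expR_ge1Dx _); rewrite lerDl mulr_ge0 ?subr_ge0.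
move=> t tab; apply/eqP; rewrite -subr_eq0 -normr_le0.
apply: (@le0_geometric _ _ (2 * k * (b - a) * expR (2 * k * (t - a)))) => n.
by have := halving step P0 n t tab; rewrite mulrAC.
Qed.

Variables (B : ((V -> V) -> R) -> V -> V) (CB : R) (xi0 : (V -> V) -> R).
Hypothesis hB : standing B CB.
Hypothesis cxi0 : is_current xi0.

Definition weakly_continuous (a b : R) (xi : R -> (V -> V) -> R) : Prop :=
  forall t, a <= t <= b -> forall e : R, 0 < e -> exists2 dt : R, 0 < dt &
    forall s, a <= s <= b -> `|s - t| < dt -> wnorm (cdiff (xi s) (xi t)) < e.

(** The case of [flow_exists] where the current ignores the pair, with Lipschitz constant 0;
    continuity in time comes from weak continuity. *)
Lemma fixed_flow (a b m A L : R) (xi : R -> (V -> V) -> R) psi J0 : a <= b ->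
  0 <= A -> A ^+ 2 <= L -> 0 <= m ->
  (forall t, a <= t <= b -> is_current (xi t) /\ wnorm (xi t) <= m) ->
  weakly_continuous a b xi -> C11 psi J0 A L ->
  exists (phi : R -> V -> V) (J : R -> V -> 'M[R]_d),
  [/\ phi a = psi /\ J a = J0,
      forall t, a <= t <= b -> C11 (phi t) (J t) (A * expR (Kfield d CB m * (t - a)))
        (L * expR (2 * Kfield d CB m * (t - a))),
      forall x, mevolves a b (phi^~ x) (fun t => B (xi t) (phi t x)),
      forall x, mevolves a b (J^~ x) (fun t => J t x *m jac (B (xi t)) (phi t x)) &
      exists2 C : R, 0 <= C & forall s t x, a <= s <= b -> a <= t <= b ->
        `|phi s x - phi t x| <= C * `|s - t| /\ opbound (J s x - J t x) (C * `|s - t|)].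
Proof.
move=> ab A0 AL m0 cxi wc hpsi.
apply: (@flow_exists _ _ B CB hB a b A L m 0 psi J0 (fun t _ _ => xi t)) => //.
- by move=> t phi J tab _; exact: cxi.
- by move=> t phi J phi' J' e _ _ _ _ _ _; rewrite mul0r wnorm_eq0.
- move=> t e tab e0; have [dt dt0 h] := wc t tab e e0; exists dt => // s phi J sab st _.
  exact/ltW/h.
Qed.

Lemma weakly_continuous_bounded (a b : R) xi : a <= b ->
  (forall t, a <= t <= b -> is_current (xi t)) -> weakly_continuous a b xi ->
  exists2 m : R, 0 <= m & forall t, a <= t <= b -> wnorm (xi t) <= m.
Proof.
move=> ab cxi wc.
have cont : continuous (fun t => wnorm (xi (clamp a b t))).
  move=> t; apply/cvgrPdist_le => e e0.
  have tab := clamp_bounds t ab; have [dt dt0 h] := wc _ tab e e0.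
  near=> s.
  have st : `|t - s| < dt by near: s; apply: cvgr_dist_lt => //; exact: cvg_id.
  have sab := clamp_bounds s ab.
  have := clamp_lipschitz a b s t; rewrite (distrC s) => /le_lt_trans/(_ st) cst.
  have := ltW (h _ sab cst).
  have := wnorm_le_dist (cxi _ sab) (cxi _ tab).
  have := wnorm_le_dist (cxi _ tab) (cxi _ sab).
  rewrite (wnormC (cxi _ tab) (cxi _ sab)) ler_norml => k1 k2 k3.
  by apply/andP; split; lra.
have [c cab hc] := EVT_max ab (continuous_subspaceT cont).
exists (wnorm (xi (clamp a b c))).
  by apply: wnorm_ge0; apply: cxi; exact: clamp_bounds.
move=> t tab; have := hc t; rewrite in_itv /= tab => /(_ isT).
by rewrite (clamp_id tab).
Unshelve. all: by end_near. Qed.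

Lemma weakly_continuous_sub (a b c e : R) xi : a <= c -> e <= b ->
  weakly_continuous a b xi -> weakly_continuous c e xi.
Proof.
move=> ac eb wc t /andP[ct te] ep ep0.
have tab : a <= t <= b by rewrite (le_trans ac ct) (le_trans te eb).
have [dt dt0 h] := wc t tab ep ep0; exists dt => // s /andP[cs se]; apply: h.
by rewrite (le_trans ac cs) (le_trans se eb).
Qed.

Lemma flow_on_evolves xi T phi x : flow_on B xi T phi ->
  mevolves 0 T (phi^~ x) (fun t => B (xi t) (phi t x)).
Proof.
move=> /(_ x) [_ [cphi dphi]] i j; split.
  by move=> t; exact: (continuous_comp (cphi t) (@coord_continuous _ _ _ i j (phi t x))).
by move=> t tT; have := derive_mx_coord (dphi t tT); exact.
Qed.

(** The flow in [sol_on] comes with no regularity in space. A C^{1,1} flow of the same velocity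
    field is constructed, and uniqueness of each trajectory identifies the two; [push] then becomes
    [pushC]. *)
Lemma sol_regular (T m : R) xi : 0 <= T -> 0 <= m -> sol_on B xi0 T xi ->
  (forall t, 0 <= t <= T -> wnorm (xi t) <= m) ->
  exists (phi : R -> V -> V) (J : R -> V -> 'M[R]_d),
  [/\ phi 0 = id /\ J 0 = (fun=> 1%:M),
      forall t, 0 <= t <= T -> C11 (phi t) (J t) (expR (Kfield d CB m * T))
        (expR (2 * Kfield d CB m * T)) /\
        forall th, Cb th -> xi t th = pushC xi0 (phi t) (J t) th,
      forall x, mevolves 0 T (phi^~ x) (fun t => B (xi t) (phi t x)),
      forall x, mevolves 0 T (J^~ x) (fun t => J t x *m jac (B (xi t)) (phi t x)) &
      exists2 C : R, 0 <= C & forall s t x, 0 <= s <= T -> 0 <= t <= T ->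
        `|phi s x - phi t x| <= C * `|s - t| /\ opbound (J s x - J t x) (C * `|s - t|)].
Proof.
move=> T0 m0 [cxi [wc [chi [fchi xiE]]]] wm.
have k0 := Kfield_gt0 hB m0.
have cm t : 0 <= t <= T -> is_current (xi t) /\ wnorm (xi t) <= m.
  by move=> tT; split; [exact: cxi|exact: wm].
have [||phi [J [[phi0 J0] hC ephi eJ hL]]] := fixed_flow T0 _ _ m0 cm wc (@C11_id R d) => //.
exists phi, J; split => // t tT; have /andP[t0 tT'] := tT.
have Ct : C11 (phi t) (J t) (expR (Kfield d CB m * T)) (expR (2 * Kfield d CB m * T)).
  apply: C11W (hC t tT); rewrite mul1r subr0 ler_expR ler_wpM2l //.
    exact: ltW.
  by rewrite mulr_ge0 // ltW.
split=> // th cth; rewrite xiE //.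
have -> : chi t = phi t.
  apply/funext => x.
  apply: (@ode_unique 0 T _ (fun t x => B (xi t) x) (chi^~ x) (phi^~ x) T0 k0) => //.
  - by move=> s y sT; have [c w] := cm s sT; exact: (field_bound hB y c w).
  - by move=> s y z sT; have [c w] := cm s sT; exact: (C11_lip (field_C11 hB c w) z y).
  - exact: flow_on_evolves.
  - by rewrite phi0; case: (fchi x).
by rewrite (push_C11 th Ct).
Qed.

(** The Gronwall iteration is run on the pairs (flow, differential): their distance controls the
    weak distance of the currents, hence that of the velocities, which closes the estimate. *)
Lemma sol_unique (T : R) xi xi' : 0 <= T -> sol_on B xi0 T xi -> sol_on B xi0 T xi' ->
  forall t, 0 <= t <= T -> forall th, Cb th -> xi t th = xi' t th.
Proof.
move=> T0 s1 s2.
have [m1 m10 hm1] := weakly_continuous_bounded T0 s1.1 s1.2.1.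
have [m2 m20 hm2] := weakly_continuous_bounded T0 s2.1 s2.2.1.
pose m := m1 + m2; have m0 : 0 <= m by rewrite addr_ge0.
have w1 t : 0 <= t <= T -> wnorm (xi t) <= m by move=> /hm1; rewrite /m; lra.
have w2 t : 0 <= t <= T -> wnorm (xi' t) <= m by move=> /hm2; rewrite /m; lra.
have [phi [J [[phi0 J0] hC ephi eJ [c c0 hc]]]] := sol_regular T0 m0 s1 w1.
have [phi' [J' [[phi0' J0'] hC' ephi' eJ' [c' c0' hc']]]] := sol_regular T0 m0 s2 w2.
have [C0 C00 hC0] := current_bound cxi0.
set A := expR (Kfield d CB m * T) in hC hC'; set L := expR (2 * Kfield d CB m * T) in hC hC'.
have A0 : 0 <= A by exact: expR_ge0.
have L0 : 0 <= L by exact: expR_ge0.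
pose Lz := C0 * (d%:R * (A + 1)).
have Lz0 : 0 <= Lz by rewrite !mulr_ge0 // addr_ge0.
pose l := Nfield d CB m A * (Lz + 1) + 1.
have N0 : 0 <= Nfield d CB m A by exact: (Nfield_ge0 hB).
have l0 : 0 < l.
  by have : 0 <= Nfield d CB m A * (Lz + 1); [rewrite mulr_ge0 // addr_ge0|rewrite /l; lra].
pose P D := 0 <= D /\ forall t x, 0 <= t <= T ->
  `|phi t x - phi' t x| <= D * expR (2 * l * (t - 0)) /\
  opbound (J t x - J' t x) (D * expR (2 * l * (t - 0))).
(* Pairs at distance [D] give currents at weak distance [Lz * D], hence right-hand sides at distance
   [l * D]. *)
have dist t D : 0 <= D -> 0 <= t <= T ->
   (forall x, `|phi t x - phi' t x| <= D /\ opbound (J t x - J' t x) D) ->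
   forall x, `|B (xi t) (phi t x) - B (xi' t) (phi' t x)| <= l * D /\
    opbound (J t x *m jac (B (xi t)) (phi t x) - J' t x *m jac (B (xi' t)) (phi' t x)) (l * D).
  move=> D0 tT h x.
  have [Ct E] := hC t tT; have [Ct' E'] := hC' t tT.
  have w : wnorm (cdiff (xi t) (xi' t)) <= Lz * D.
    rewrite (@wnorm_ext _ _ _ (cdiff (pushC xi0 (phi t) (J t)) (pushC xi0 (phi' t) (J' t)))).
      apply: (wnorm_pushC_dist cxi0 C00 A0 L0 D0 hC0 Ct Ct') => y.
        by case: (h y).
      by case: (h y).
    by move=> th cth; rewrite /cdiff E // E'.
  have [hx1 hx2] := h x.
  have [r1 r2] := system_dist hB (s1.1 t tT) (s2.1 t tT) (w1 t tT) w (w2 t tT) A0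
    (C11_op Ct' x) D0 hx1 hx2.
  have le : Nfield d CB m A * (Lz * D + D) <= l * D by rewrite /l; lra.
  by split; [exact: le_trans r1 le|exact: opboundW r2].
have step D : P D -> P (D / 2).
  move=> [D0 hD]; split; first by rewrite divr_ge0.
  move=> t x /andP[t0 tT].
  have ev := evolves_exp 0 t (2 * l) (D / 2).
  have bnd s : 0 < s < t -> forall x, 
     `|B (xi s) (phi s x) - B (xi' s) (phi' s x)| <= D / 2 * (2 * l * expR (2 * l * (s - 0))) /\
    opbound (J s x *m jac (B (xi s)) (phi s x) - J' s x *m jac (B (xi' s)) (phi' s x))
      (D / 2 * (2 * l * expR (2 * l * (s - 0)))).
    move=> /andP[/ltW s0 /ltW st] y.
    have sT : 0 <= s <= T by rewrite s0 (le_trans st tT).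
    have := @dist s (D * expR (2 * l * (s - 0))) (mulr_ge0 D0 (expR_ge0 _)) sT (fun x => hD s x sT) y.
    by have -> : l * (D * expR (2 * l * (s - 0))) = D / 2 * (2 * l * expR (2 * l * (s - 0))) by field.
  have e0 : D / 2 * expR (2 * l * (t - 0)) - D / 2 * expR (2 * l * (0 - 0))
      <= D / 2 * expR (2 * l * (t - 0)).
    by rewrite subrr mulr0 expR0 mulr1; lra.
  split.
    have := @mevolves_le _ _ _ 0 t _ _ _ _ t0 (mevolvesB (mevolves_sub (lexx _) tT (ephi x))
      (mevolves_sub (lexx _) tT (ephi' x))) ev.
    rewrite phi0 phi0' subrr subr0 => /(_ _)/le_trans; apply => //.
    by move=> s /bnd/(_ x) [].
  move=> v.
  have evv : evolves 0 t (fun s => `|v| * (D / 2 * expR (2 * l * (s - 0))))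
     (fun s => `|v| * (D / 2 * (2 * l * expR (2 * l * (s - 0))))) by exact: evolvesZ.
  have := @mevolves_le _ _ _ 0 t _ _ _ _ t0 (mevolvesMl v (mevolvesB (mevolves_sub (lexx _) tT (eJ x))
      (mevolves_sub (lexx _) tT (eJ' x)))) evv.
  rewrite J0 J0' subrr mulmx0 subr0 => /(_ _)/le_trans; apply.
    by move=> s /bnd/(_ x) [_ h]; rewrite mulrC; exact: h.
  by rewrite -mulrBr mulrC ler_wpM2r.
(* The iteration starts from the time-Lipschitz bounds, both pairs being the identity at time 0. *)
have P0 : P ((c + c') * T).
  split; first by rewrite mulr_ge0 // addr_ge0.
  move=> t x tT; have /andP[t0 tT'] := tT.
  have zT : 0 <= (0 : R) <= T by rewrite lexx T0.
  have [a1 a2] := hc t 0 x tT zT; have [b1 b2] := hc' t 0 x tT zT.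
  have le : c * `|t - 0| + c' * `|t - 0| <= (c + c') * T * expR (2 * l * (t - 0)).
    rewrite -mulrDl subr0 (ger0_norm t0) -[leLHS]mulr1; apply: ler_pM => //.
    - by rewrite mulr_ge0 // addr_ge0.
    - by rewrite ler_wpM2l // addr_ge0.
    - apply: le_trans (expR_ge1Dx _); rewrite lerDl mulr_ge0 //.
      by rewrite mulr_ge0 // ltW.
  split.
    have -> : phi t x - phi' t x = (phi t x - phi 0 x) - (phi' t x - phi' 0 x).
      by rewrite phi0 phi0' opprB addrA subrK.
    by apply: le_trans (ler_normB _ _) _; apply: le_trans le; exact: lerD.
  have -> : J t x - J' t x = (J t x - J 0 x) + - (J' t x - J' 0 x).
    by rewrite J0 J0' opprB addrA subrK.
  apply: opboundW le _; apply: opboundD => // v.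
  by rewrite mulmxN normrN; exact: b2.
have small t x : 0 <= t <= T -> phi t x = phi' t x /\ J t x = J' t x.
  move=> tT; split.
    apply/eqP; rewrite -subr_eq0 -normr_le0.
    apply: (@le0_geometric _ _ ((c + c') * T * expR (2 * l * (t - 0)))) => n.
    by have [_ /(_ t x tT) [h _]] := halving step P0 n; rewrite mulrAC.
  apply/matrixP => i j; apply/eqP; rewrite -subr_eq0 -normr_le0.
  apply: (@le0_geometric _ _ ((c + c') * T * expR (2 * l * (t - 0)))) => n.
  have [_ /(_ t x tT) [_ h]] := halving step P0 n; rewrite mulrAC.
  by have := opbound_coord i j h; rewrite !mxE.
move=> t tT th cth; have [_ ->] := hC t tT => //; have [_ ->] := hC' t tT => //.
have -> : phi t = phi' t by apply/funext => x; have [] := small t x tT.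
by have -> : J t = J' t by apply/funext => x; have [] := small t x tT.
Qed.

End Solutions.

(** * Weak growth, extension of solutions and bootstrap *)

Section Continuation.
Variables (R : realType) (d : nat).
Local Notation V := 'rV[R]_d.
Variables (B : ((V -> V) -> R) -> V -> V) (CB : R) (xi0 : (V -> V) -> R).
Hypothesis hB : standing B CB.
Hypothesis cxi0 : is_current xi0.

(** With [chi] the flow started at [t1], the flow from 0 factors through [chi], so [xi t2] is the
    push-forward of [xi t1] by [chi t2]. The bound [m] only limits the length of the interval and is
    absent from the growth factor. *)
Lemma weak_growth (T t1 t2 m : R) xi : 0 <= t1 -> t1 <= t2 -> t2 <= T -> 0 <= m ->
  sol_on B xi0 T xi -> (forall s, t1 <= s <= t2 -> wnorm (xi s) <= m) ->
  expR (Kfield d CB m * (t2 - t1)) <= 2 ->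
  wnorm (xi t2) <= (d%:R + 1) * 11 * wnorm (xi t1).
Proof.
move=> t10 t12 t2T m0 sol wm e2.
have T0 : 0 <= T by lra.
have k0 := Kfield_gt0 hB m0.
have [cxi [wc _]] := sol.
have sub s : t1 <= s <= t2 -> 0 <= s <= T by move=> /andP[? ?]; apply/andP; split; lra.
have t2in : t1 <= t2 <= t2 by rewrite t12 lexx.
have t1in : t1 <= t1 <= t2 by rewrite lexx.
(* This bound only provides a regular flow on [[0, T]]; it enters no constant of the conclusion. *)
have [m' m'0 hm'] := weakly_continuous_bounded T0 cxi wc.
have [phi [J [_ hC ephi _ _]]] := sol_regular hB T0 m'0 sol hm'.
have cm s : t1 <= s <= t2 -> is_current (xi s) /\ wnorm (xi s) <= m.
  by move=> st; split; [exact/cxi/sub|exact: wm].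
have [||chi [H [[chi1 _] hchi echi _ _]]] := fixed_flow hB t12 _ _ m0 cm
  (weakly_continuous_sub t10 t2T wc) (@C11_id R d) => //.
have comp : phi t2 = chi t2 \o phi t1.
  apply/funext => x.
  apply: (@ode_unique _ _ t1 t2 _ (fun t x => B (xi t) x) (phi^~ x)
    (fun t => chi t (phi t1 x)) t12 k0) => //.
  - by move=> s y st; have [c w] := cm s st; exact: (field_bound hB y c w).
  - by move=> s y z st; have [c w] := cm s st; exact: (C11_lip (field_C11 hB c w) z y).
  - exact: mevolves_sub (ephi x).
  - by rewrite chi1.
have Cchi : C11 (chi t2) (H t2) 2 4.
  apply: C11W (hchi t2 t2in); rewrite mul1r //.
  have -> : 2 * Kfield d CB m * (t2 - t1) =
    Kfield d CB m * (t2 - t1) + Kfield d CB m * (t2 - t1) by ring.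
  rewrite expRD.
  have := expR_ge0 (Kfield d CB m * (t2 - t1)); nra.
have [C1 E1] := hC t1 (sub _ t1in); have [C2 E2] := hC t2 (sub _ t2in).
have Ccomp := C11_comp (ler0n R 2) (ler0n R 4) (expR_ge0 _) Cchi C1.
have pE th : Cb th -> xi t2 th = pushC (xi t1) (chi t2) (H t2) th.
  move=> cth; rewrite E2 // /pushC E1; last exact: (pushJ_Cb _ _ Cchi).
  (* Passing through [push], which depends on the map alone, replaces [J t2] by the chain-rule
     differential without comparing the two. *)
  rewrite /pushC -(push_C11 th C2) comp (push_C11 th Ccomp); congr xi0.
  by apply/funext => x; rewrite /pushJ trmx_mul mulmxA.
rewrite (wnorm_ext pE).
have := wnorm_pushC_le (cxi _ (sub _ t1in)) (ler0n R 2) (ler0n R 4) Cchi.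
(* The factor is [A + A^2 + L + 1] at [A = 2], [L = 4]. *)
by have -> : 2 + 2 ^+ 2 + 4 + 1 = 11 :> R by ring.
Qed.

Lemma within_eq_continuous (W : topologicalType) (a b : R) (f g : R -> W) :
  (forall t, a <= t <= b -> f t = g t) -> continuous f -> {within `[a, b], continuous g}.
Proof.
move=> e cf; apply: (@subspace_eq_continuous _ _ _ f) => [t|].
  by rewrite inE /= in_itv /=; exact: e.
exact: continuous_subspaceT.
Qed.

(** The coupled system is restarted at [T] from the pair reached there. As long as the constant [A]
    at most doubles, the weak norm of the current is bounded through its strong norm, so the
    admissible [tau] depends on [A] and [C] only. *)
Lemma sol_extend (T tau m A C : R) xi : 0 <= T -> 0 <= m -> 0 <= tau -> 0 <= C ->
  (forall th, Cb th -> forall M, (forall x, `|th x| <= M) -> `|xi0 th| <= C * M) ->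
  sol_on B xi0 T xi -> (forall t, 0 <= t <= T -> wnorm (xi t) <= m) ->
  expR (Kfield d CB m * T) <= A ->
  expR (Kfield d CB (C * (d%:R * (2 * A))) * tau) <= 2 ->
  exists xi', sol_on B xi0 (T + tau) xi'.
Proof.
move=> T0 m0 tau0 C0 hC sol wm eA etau.
have [cxi _] := sol.
have A0 : 0 <= A by exact: le_trans eA; exact: expR_ge0.
(* The bound of [wnorm_pushC] for a map whose first-order constant has doubled to [2 * A]. *)
set m' := C * (d%:R * (2 * A)) in etau.
have m'0 : 0 <= m' by rewrite !mulr_ge0.
have [phi [J [[phi0 J0] hreg ephi eJ [c c0 hc]]]] := sol_regular hB T0 m0 sol wm.
pose L := A ^+ 2; have L0 : 0 <= L by rewrite exprn_ge0.
have A2 : 0 <= 2 * A by rewrite mulr_ge0.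
have L4 : 0 <= 4 * L by rewrite mulr_ge0.
have Creg t : 0 <= t <= T -> C11 (phi t) (J t) A L.
  move=> tT; have [h _] := hreg t tT; apply: C11W h => //.
  have -> : 2 * Kfield d CB m * T = Kfield d CB m * T + Kfield d CB m * T by ring.
  rewrite expRD /L expr2.
  by apply: ler_pM; rewrite ?expR_ge0.
pose T' := T + tau; have TT' : T <= T' by rewrite lerDl.
have cAle : A * expR (Kfield d CB m' * (T' - T)) <= 2 * A.
  by rewrite /T' addrC addKr mulrC ler_wpM2r.
have cLle : L * expR (2 * Kfield d CB m' * (T' - T)) <= 4 * L.
  rewrite /T' addrC addKr mulrC ler_wpM2r //.
  have -> : 2 * Kfield d CB m' * tau = Kfield d CB m' * tau + Kfield d CB m' * tau by ring.
  rewrite expRD; have := expR_ge0 (Kfield d CB m' * tau); nra.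
pose Lz := C * (d%:R * (2 * A + 1)).
have Lz0 : 0 <= Lz by rewrite !mulr_ge0 // addr_ge0.
have TinT : 0 <= T <= T by rewrite T0 lexx.
(* The current is always [xi0] pushed by the full map, which now starts from [phi T]: [chi] directly
   continues the flow from time 0. *)
have [|||chi [H [[chiT HT] hchi echi _ [c' c'0 hc']]]] :=
  @flow_exists _ _ B CB hB T T' A L m' Lz (phi T) (J T) (fun _ => pushC xi0)
    TT' A0 (lexx _) m'0 Lz0 (Creg T TinT).
- move=> t p P _ h; have h' := C11W cAle cLle h.
  by split; [exact: pushC_current h'|exact: wnorm_pushC h'].
- move=> t p P q Q e _ e0 h1 h2.
  exact: (wnorm_pushC_dist cxi0 C0 A2 L4 e0 hC (C11W cAle cLle h1) (C11W cAle cLle h2)).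
- move=> t e _ e0; exists 1 => // s p P _ _ _; apply: le_trans (ltW e0).
  exact: wnorm_eq0.
pose gphi t := if t <= T then phi t else chi t.
pose gJ t := if t <= T then J t else H t.
pose gxi t := pushC xi0 (gphi t) (gJ t).
have gr t : T <= t -> gphi t = chi t /\ gJ t = H t.
  rewrite /gphi /gJ le_eqVlt => /orP[/eqP <-|Tt]; first by rewrite lexx chiT HT.
  by rewrite leNgt Tt.
have gl t : t <= T -> gphi t = phi t /\ gJ t = J t by rewrite /gphi /gJ => ->.
have gC t : 0 <= t <= T' -> C11 (gphi t) (gJ t) (2 * A) (4 * L).
  move=> /andP[t0 tT']; have [tT|/ltW Tt] := leP t T.
    have [-> ->] := gl t tT; apply: C11W (Creg t _); [lra|lra|by rewrite t0].
  have [-> ->] := gr t Tt; have tin : T <= t <= T' by rewrite Tt.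
  apply: C11W (hchi t tin).
    apply: le_trans cAle; rewrite ler_wpM2l // ler_expR ler_wpM2l ?lerB //.
    exact/ltW/(Kfield_gt0 hB).
  apply: le_trans cLle; rewrite ler_wpM2l // ler_expR ler_wpM2l ?lerB //.
  by rewrite mulr_ge0 //; exact/ltW/(Kfield_gt0 hB).
pose c2 := c + c'; have c20 : 0 <= c2 by rewrite addr_ge0.
have gLip s t x : 0 <= s <= T' -> 0 <= t <= T' ->
    `|gphi s x - gphi t x| <= c2 * `|s - t| /\ opbound (gJ s x - gJ t x) (c2 * `|s - t|).
  have wl s' t' x' : 0 <= s' -> s' <= t' -> t' <= T' ->
      `|gphi s' x' - gphi t' x'| <= c2 * (t' - s') /\
      opbound (gJ s' x' - gJ t' x') (c2 * (t' - s')).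
    move=> s0 st tT'.
    have l1 p q : 0 <= p -> p <= q -> q <= T -> `|gphi p x' - gphi q x'| <= c * (q - p) /\
        opbound (gJ p x' - gJ q x') (c * (q - p)).
      move=> p0 pq qT; have [-> ->] := gl p (le_trans pq qT); have [-> ->] := gl q qT.
      have := hc p q x'; rewrite p0 (le_trans pq qT) qT (le_trans p0 pq) /= => /(_ isT isT).
      by rewrite (distrC p q) [`|q - p|]ger0_norm ?subr_ge0.
    have l2 p q : T <= p -> p <= q -> q <= T' -> `|gphi p x' - gphi q x'| <= c' * (q - p) /\
        opbound (gJ p x' - gJ q x') (c' * (q - p)).
      move=> p0 pq qT; have [-> ->] := gr p p0; have [-> ->] := gr q (le_trans p0 pq).
      have := hc' p q x'; rewrite p0 (le_trans pq qT) qT (le_trans p0 pq) /= => /(_ isT isT).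
      by rewrite (distrC p q) [`|q - p|]ger0_norm ?subr_ge0.
    have [tT|/ltW Tt] := leP t' T.
      have [r1 r2] := l1 s' t' s0 st tT.
      have le : c * (t' - s') <= c2 * (t' - s') by rewrite ler_wpM2r ?subr_ge0 // lerDl.
      by split; [exact: le_trans r1 le|exact: opboundW r2].
    have [sT|/ltW Ts] := leP s' T; last first.
      have [r1 r2] := l2 s' t' Ts st tT'.
      have le : c' * (t' - s') <= c2 * (t' - s') by rewrite ler_wpM2r ?subr_ge0 // lerDr.
      by split; [exact: le_trans r1 le|exact: opboundW r2].
    have [r1 r2] := l1 s' T s0 sT (lexx _); have [r3 r4] := l2 T t' (lexx _) Tt tT'.
    have le : c * (T - s') + c' * (t' - T) <= c2 * (t' - s').
      have : 0 <= c' * (T - s') by rewrite mulr_ge0 // subr_ge0.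
      have : 0 <= c * (t' - T) by rewrite mulr_ge0 // subr_ge0.
      by rewrite /c2; lra.
    split.
      apply: le_trans (ler_distD (gphi T x') _ _) _; apply: le_trans le; exact: lerD.
    have -> : gJ s' x' - gJ t' x' = (gJ s' x' - gJ T x') + (gJ T x' - gJ t' x').
      by rewrite addrA subrK.
    exact: opboundW le (opboundD r2 r4).
  move=> /andP[s0 sT] /andP[t0 tT]; have [st|/ltW ts] := leP s t.
    by rewrite (distrC s t) [`|t - s|]ger0_norm ?subr_ge0 //; exact: wl.
  have [r1 r2] := wl t s x t0 ts sT.
  rewrite [`|s - t|]ger0_norm ?subr_ge0 // distrC; split => // v.
  by rewrite -opprB mulmxN normrN; exact: r2.
have gcur t : 0 <= t <= T' -> is_current (gxi t) by move=> /gC; exact: pushC_current.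
have gw t : 0 <= t <= T' -> wnorm (gxi t) <= m' by move=> /gC; exact: wnorm_pushC.
have gdist s t : 0 <= s <= T' -> 0 <= t <= T' ->
    wnorm (cdiff (gxi s) (gxi t)) <= Lz * (c2 * `|s - t|).
  move=> sT tT; apply: (wnorm_pushC_dist cxi0 C0 A2 L4 _ hC (gC s sT) (gC t tT)).
  - by rewrite mulr_ge0.
  - by move=> x; have [] := gLip s t x sT tT.
  - by move=> x; have [] := gLip s t x sT tT.
have T'0 : 0 <= T' by exact: le_trans TT'.
have gev x : mevolves 0 T' (gphi^~ x) (fun t => B (gxi t) (gphi t x)).
  move=> i j; apply: (evolves_glue T0 TT').
  - apply: (@lipschitz_continuous _ _ _ _ (Nfield d CB m' 0 * (Lz * c2 + c2))) => s t.
    have sT := clamp_bounds s T'0; have tT := clamp_bounds t T'0.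
    set s' := clamp 0 T' s in sT *; set t' := clamp 0 T' t in tT *.
    have [hx _] := gLip t' s' x tT sT.
    have op0 e : 0 <= e -> opbound (0 - 0 : 'M[R]_d) e.
      by move=> e0 v; rewrite subrr mulmx0 normr0 mulr_ge0.
    have op00 : opbound (0 : 'M[R]_d) 0 by move=> v; rewrite mulmx0 normr0 mul0r.
    (* Only the map component is wanted, so the matrices are taken to be zero. The resulting
       Lipschitz bound gives the continuity in time that gluing at [T] requires. *)
    have [r _] := @system_dist _ _ B CB hB _ _ m' _ (c2 * `|t' - s'|) 0 _ _ 0 0
      (gcur _ tT) (gcur _ sT) (gw _ tT) (gdist _ _ tT sT) (gw _ sT) (lexx _)
      op00 (mulr_ge0 c20 (normr_ge0 _)) hx (op0 _ (mulr_ge0 c20 (normr_ge0 _))).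
    have := mx_coord_le (B (gxi t') (gphi t' x) - B (gxi s') (gphi s' x)) i j.
    rewrite !mxE => /le_trans; apply.
    apply: le_trans r _.
    rewrite mulrA -mulrDl mulrA ler_wpM2l //; last exact: clamp_lipschitz.
    apply: mulr_ge0; first exact: (Nfield_ge0 hB).
    by apply: addr_ge0 => //; exact: mulr_ge0.
  - apply: (@evolves_eq _ _ _ (fun t => phi t x i j)).
      by move=> t /andP[_ tT]; have [-> _] := gl t tT.
    apply: evolves_ext (ephi x i j) => t /andP[/ltW t0 /ltW tT].
    have tin : 0 <= t <= T by rewrite t0.
    have tin' : 0 <= t <= T' by rewrite t0 (le_trans tT).
    have [_ E] := hreg t tin; have [gE gE'] := gl t tT.
    have e th : Cb th -> xi t th = gxi t th by move=> cth; rewrite E // /gxi gE gE'.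
    rewrite gE; have [r _] := field_dist hB (phi t x) (cxi t tin) (gcur t tin') (wnorm_eq0 e).
    by move: r; rewrite mulr0 normr_le0 subr_eq0 => /eqP ->.
  - apply: (@evolves_eq _ _ _ (fun t => chi t x i j)).
      by move=> t /andP[Tt _]; have [-> _] := gr t Tt.
    apply: evolves_ext (echi x i j) => t /andP[/ltW Tt _].
    by rewrite /gxi; have [-> ->] := gr t Tt.
exists gxi; split => //; split.
  move=> t tT e e0; have q0 : 0 <= Lz * c2 by rewrite mulr_ge0.
  have q1 : 0 < Lz * c2 + 1 by lra.
  exists (e / (Lz * c2 + 1)); first exact: divr_gt0.
  move=> s sT; rewrite ltr_pdivlMr // => st.
  apply: le_lt_trans (gdist s t sT tT) _; apply: le_lt_trans st.
  by rewrite mulrA mulrC; have := normr_ge0 (s - t); lra.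
exists gphi; split.
  move=> x; split; first by have [-> _] := gl 0 T0; rewrite phi0.
  split; last by move=> t tT'; exact: mevolves_derive (gev x).
  apply: (@within_eq_continuous _ _ _ (fun t => gphi (clamp 0 T' t) x)).
    by move=> t tT; rewrite clamp_id.
  apply: (@lipschitz_continuous _ _ _ _ c2) => s t.
  have [h _] := gLip _ _ x (clamp_bounds t T'0) (clamp_bounds s T'0).
  by apply: le_trans h _; rewrite ler_wpM2l //; exact: clamp_lipschitz.
by move=> t tT th cth; rewrite (push_C11 th (gC t tT)).
Qed.

(** Consider the supremum [c] of the times up to which the weak bound [m + 1] holds. The bound
    improves to [m] before [c], so continuity carries [m + 1] past [c] unless [c = b]. *)
Lemma bootstrap (a b m : R) (f : R -> R) : a <= b ->
  (forall t, a <= t <= b -> forall e : R, 0 < e -> exists2 dt : R, 0 < dt &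
     forall s, a <= s <= b -> `|s - t| < dt -> `|f s - f t| < e) ->
  (forall t, a <= t <= b -> (forall s, a <= s <= t -> f s <= m + 1) -> f t <= m) ->
  f a <= m -> forall t, a <= t <= b -> f t <= m.
Proof.
move=> ab cf hf fa.
pose E := [set t | a <= t <= b /\ forall s, a <= s <= t -> f s <= m + 1].
have Ea : E a.
  split; first by rewrite lexx.
  by move=> s /le_anti <-; lra.
have ubE : has_ubound E by exists b => t [/andP[]].
pose c := sup E.
have ac : a <= c by exact: ub_le_sup.
have cb : c <= b by apply: ge_sup; [exists a|move=> t [/andP[]]].
have cab : a <= c <= b by rewrite ac.
have below s : a <= s -> s < c -> f s <= m.
  move=> as_ sc; have [e [/andP[ae eb] he] se] := sup_gt (ex_intro _ a Ea) sc.
  apply: hf; first by rewrite as_ (le_trans (ltW se)).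
  by move=> r /andP[ar rs]; apply: he; rewrite ar (le_trans rs) // ltW.
(* The tolerance is spent twice, once to reach [c] from the left and once to leave it to the right;
   the total stays below 1. *)
have h0 : 0 < 1 / 4 :> R by lra.
have [dt dt0 hdt] := cf c cab (1 / 4) h0.
have fc : f c <= m + 1 / 4.
  move: ac; rewrite le_eqVlt => /orP[/eqP <-|ac]; first lra.
  pose s := Num.max a (c - dt / 2).
  have sc : s < c by rewrite gt_max ac /=; lra.
  have as_ : a <= s by rewrite le_max lexx.
  have cs : c - dt / 2 <= s by rewrite le_max lexx orbT.
  have sab : a <= s <= b by rewrite as_ (le_trans (ltW sc)).
  have := hdt s sab; rewrite ltr0_norm ?subr_lt0 // => /(_ _)/wrap[]; first lra.
  rewrite ltr_norml => /andP[h1 _]; have := below s as_ sc; lra.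
pose t := Num.min b (c + dt / 2).
have tb : t <= b by rewrite ge_min lexx.
have ct : c <= t by rewrite le_min cb /=; lra.
have Et : E t.
  split; first by rewrite (le_trans ac ct).
  move=> s /andP[as_ st]; have [sc|cs] := ltP s c.
    by have := below s as_ sc; lra.
  have st' : s <= c + dt / 2 by apply: (le_trans st); rewrite ge_min lexx orbT.
  have sab : a <= s <= b by rewrite as_ (le_trans st).
  have := hdt s sab; rewrite ger0_norm ?subr_ge0 // => /(_ _)/wrap[]; first lra.
  by rewrite ltr_norml => /andP[_ h1]; lra.
have tc : t <= c by exact: ub_le_sup.
have bc : b = c.
  move: tc; rewrite /t ge_min => /orP[bc|]; last lra.
  by apply/le_anti; rewrite bc.
have [_ hE] := Et.
move=> s /andP[as_ sb]; apply: hf; first by rewrite as_.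
move=> r /andP[ar rs]; apply: hE; by rewrite ar (le_trans rs) // (le_trans sb) // bc.
Qed.

End Continuation.

(** * Blow-up of the weak norm at a finite maximal time *)

Lemma exists_doubling_time (R : realType) (k : R) : 0 < k ->
  exists2 tau : R, 0 < tau & forall s, s <= tau -> expR (k * s) <= 2.
Proof.
move=> k0; exists (ln 2 / k); first by rewrite divr_gt0 // ln_gt0 // ltr1n.
move=> s; rewrite ler_pdivlMr // mulrC => h.
by rewrite -[leRHS]lnK ?posrE // ler_expR.
Qed.

Theorem theorem3p6 (R : realType) (d : nat)
  (B : (('rV[R]_d -> 'rV[R]_d) -> R) -> 'rV[R]_d -> 'rV[R]_d) (CB : R)
  (xi0 : ('rV[R]_d -> 'rV[R]_d) -> R) (Tmax : R) (xi : R -> ('rV[R]_d -> 'rV[R]_d) -> R) :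
  standing B CB ->
  is_current xi0 ->
  ereal_sup [set T%:E | T in [set T : R | 0 < T /\ unique_sol_on B xi0 T]] = Tmax%:E ->
  (forall T, 0 < T < Tmax -> sol_on B xi0 T xi) ->
  wnorm (xi t) @[t --> Tmax^'-] --> +oo.
Proof.
move=> hB cxi0 hsup hsol.
have maxT T : 0 < T -> unique_sol_on B xi0 T -> T <= Tmax.
  by move=> T0 hT; rewrite -lee_fin -hsup; apply: ereal_sup_ubound; exists T.
have Tmax0 : 0 < Tmax.
  (* An empty set of existence times would have supremum minus infinity, whereas the supremum is the
     real [Tmax]. *)
  have [E0|/set0P[T [T0 hT]]] := eqVneq [set T : R | 0 < T /\ unique_sol_on B xi0 T] set0.
    by move: hsup; rewrite E0 image_set0 ereal_sup0.
  exact: lt_le_trans T0 (maxT T T0 hT).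
apply/cvgryPge => A0; apply: contrapT => nnear.
(* The negation of divergence: some level [A0] is not exceeded at times arbitrarily close to
   [Tmax]. *)
have freq (e : R) : 0 < e -> exists t, [/\ 0 < t, Tmax - e < t, t < Tmax & wnorm (xi t) <= A0].
  move=> e0; apply: contrapT => /forallNP h; apply: nnear.
  near=> t; rewrite leNgt; apply/negP => wt; apply: (h t); split; last exact: ltW.
  - by near: t; exact: nbhs_left_gt.
  - by near: t; apply: nbhs_left_gt; lra.
  - by near: t; exact: nbhs_left_lt.
have [C C0 hC] := current_bound cxi0.
have D1 : 1 <= d%:R + 1 :> R by rewrite lerDr.
pose M := `|A0|; pose m := (d%:R + 1) * 11 * M.
have M0 : 0 <= M by exact: normr_ge0.
have Mm : M <= m by rewrite /m; nra.
have m0 : 0 <= m by exact: le_trans Mm.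
have m10 : 0 <= m + 1 by lra.
(* The time step is fixed from the bootstrap bound [m + 1] before [t1] is chosen within [tau] of
   [Tmax], so a single application of [weak_growth] reaches any time in between. *)
have [tau tau0 htau] := exists_doubling_time (Kfield_gt0 hB m10).
have [t1 [t10 t1tau t1T wt1]] := freq tau tau0.
have wt1M : wnorm (xi t1) <= M by apply: le_trans wt1 _; exact: ler_norm.
have late t : t1 <= t -> t < Tmax -> wnorm (xi t) <= m.
  move=> t1t tT; have t0 : 0 < t by lra.
  have sol : sol_on B xi0 t xi by apply: hsol; rewrite t0.
  have [cxi [wc _]] := sol.
  have sub s : t1 <= s <= t -> 0 <= s <= t by move=> /andP[? ?]; apply/andP; split; lra.
  apply: (@bootstrap _ t1 t m (fun t => wnorm (xi t)) t1t).
  - move=> s st e e0; have [dt dt0 h] := wc s (sub s st) e e0.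
    exists dt => // r rt rs; have := h r (sub r rt) rs.
    have cr := cxi r (sub r rt); have cs := cxi s (sub s st).
    have := wnorm_le_dist cr cs; have := wnorm_le_dist cs cr.
    by rewrite (wnormC cs cr) ltr_norml => ? ? ?; apply/andP; split; lra.
  - move=> s /andP[t1s st] hs.
    apply: le_trans (weak_growth hB (ltW t10) t1s st m10 sol hs _) _.
      by apply: htau; lra.
    by rewrite /m ler_wpM2l //; lra.
  - exact: le_trans Mm.
  - by rewrite t1t lexx.
have [m1 m1_0 early] : exists2 m1 : R, 0 <= m1 & forall t, 0 <= t <= t1 -> wnorm (xi t) <= m1.
  have [cxi [wc _]] : sol_on B xi0 t1 xi by apply: hsol; rewrite t10.
  exact: weakly_continuous_bounded (ltW t10) cxi wc.
pose m2 := m + m1; have m20 : 0 <= m2 by rewrite addr_ge0.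
have bnd t : 0 <= t -> t < Tmax -> wnorm (xi t) <= m2.
  move=> t0 tT; have [tt1|/ltW t1t] := leP t t1.
    by have := early t; rewrite t0 tt1 => /(_ isT); rewrite /m2; lra.
  by have := late t t1t tT; rewrite /m2; lra.
(* This bounds the differential of the flow at every time before [Tmax]; the extension time [tau']
   therefore does not depend on the restart time [T], which can be taken within [tau'] of [Tmax]. *)
pose A := expR (Kfield d CB m2 * Tmax).
have A_ge0 : 0 <= A by exact: expR_ge0.
have m'0 : 0 <= C * (d%:R * (2 * A)) by rewrite !mulr_ge0.
have [tau' tau'0 htau'] := exists_doubling_time (Kfield_gt0 hB m'0).
have [T [T0 Ttau TT _]] := freq tau' tau'0.
have solT : sol_on B xi0 T xi by apply: hsol; rewrite T0.
have [||eta seta] := sol_extend hB cxi0 (ltW T0) m20 (ltW tau'0) C0 hC solT _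
  (_ : _ <= A) (htau' _ (lexx _)).
- by move=> t /andP[t0 tT]; apply: bnd => //; lra.
- by rewrite ler_expR ler_wpM2l // ltW //; exact: (Kfield_gt0 hB).
(* Since [Tmax - tau' < T], a unique solution up to [T + tau'] contradicts the definition of [Tmax]
   as a supremum. *)
suff : T + tau' <= Tmax by lra.
apply: maxT; first lra.
split; first by exists eta.
by move=> x y; apply: (sol_unique hB cxi0); lra.
Unshelve. all: by end_near. Qed.
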